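(* Consider the decision problem \textsc{Min-Max-Dec}: given an instance $(N,P,T,(\mathbf{D}_i)_{i\in N})$ and a set of constraints $\mathbf{A}=\{(t_1,\lambda_1),\dots,(t_\tau,\lambda_\tau)\}$, decide whether there is an outcome $\mathbf{o}$ such that $\max_{i\in N} d_i(\mathbf{o}^{(t)})\le \lambda$ for every $(t,\lambda)\in\mathbf{A}$. If $\gamma=1$, then there is a polynomial-time algorithm for \textsc{Min-Max-Dec}.
   Context: An instance is a tuple $(N,P,T,(\mathbf{D}_i)_{i\in N})$ with agents $N=[n]$, projects $P=\{p_1,\dots,p_m\}$, timesteps $T=[\ell]$, and for each agent $i$ and timestep $k$ a disapproval set $D_{ik}\subseteq P$; $\mathbf{D}_i=(D_{i1},\dots,D_{i\ell})$. An outcome is a vector $\mathbf{o}=(o_1,\dots,o_\ell)$ with $o_k\in P$. Its $k$-truncation is $\mathbf{o}^{(k)}=(o_1,\dots,o_k)$, and the disutility of agent $i$ is $d_i(\mathbf{o}^{(k)})=|\{t\in[k]: o_t\in D_{it}\}|$ (with $d_i(\mathbf{o})=d_i(\mathbf{o}^{(\ell)})$). A set of constraints is $\mathbf{A}=\{(t_1,\lambda_1),\dots,(t_\tau,\lambda_\tau)\}$ with $t_j\in T$, $\lambda_j\in\{0,\dots,\ell\}$, $t_1\le\dots\le t_\tau$ and $\lambda_1\le\dots\le\lambda_\tau$; $\tau=|\mathbf{A}|$. The parameter $\gamma=\max_{k\in T,p\in P}|\{i\in N: p\in D_{ik}\}|$ is the maximum number of agents disapproving any single project at any timestep. *)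

(* Defs.v *)
From mathcomp Require Import all_boot all_order.
Set Implicit Arguments. Unset Strict Implicit. Unset Printing Implicit Defensive.

(* Agents N = 'I_n, projects P = 'I_m, timesteps T = 'I_l (timestep    *)
(* k+1 of the paper is index k : 'I_l).  D i k = D_{i,k+1}.            *)

Section Problem.
Variables (n m l : nat).
Implicit Types (D : 'I_n -> 'I_l -> {set 'I_m}) (o : 'I_l -> 'I_m).

Definition disutil D (i : 'I_n) o (t : nat) : nat :=
  #|[set k : 'I_l | (k < t) && (o k \in D i k)]|.

Definition gamma D : nat :=
  \max_(k : 'I_l) \max_(p : 'I_m) #|[set i : 'I_n | p \in D i k]|.

Definition valid_constraints (A : seq (nat * nat)) : Prop :=
  [/\ uniq A,
      all (fun c => (1 <= c.1 <= l) && (c.2 <= l)) A,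
      sorted (fun x y => x.1 <= y.1) A &
      sorted (fun x y => x.2 <= y.2) A].

Definition min_max_feasible D (A : seq (nat * nat)) : Prop :=
  exists o : 'I_l -> 'I_m,
    forall c, c \in A -> \max_(i < n) disutil D i o c.1 <= c.2.

Definition encode D (A : seq (nat * nat)) : seq nat :=
  [:: n; m; l; size A]
  ++ flatten [seq flatten [seq [seq nat_of_bool (p \in D i k) | p <- enum 'I_m]
                          | k <- enum 'I_l] | i <- enum 'I_n]
  ++ flatten [seq [:: c.1; c.2] | c <- A].

End Problem.

(* Model of computation: unit-cost RAM (registers indexed by nat,      *)
(* holding nats) with addition, truncated subtraction, indirect        *)
(* addressing and conditional jumps.  No multiplication, so unit cost  *)
(* is polynomially equivalent to Turing machines.                      *)

Inductive instr : Type :=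
  | IConst of nat & nat
  | IAdd of nat & nat & nat
  | ISub of nat & nat & nat
  | ILoad of nat & nat
  | IStore of nat & nat
  | IJz of nat & nat.

Definition program := seq instr.

Record state := State { pc : nat; mem : nat -> nat }.

Definition upd (M : nat -> nat) (r v : nat) : nat -> nat :=
  fun x => if x == r then v else M x.

Definition exec_instr (s : state) (ins : instr) : state :=
  let M := mem s in let p := pc s in
  match ins with
  | IConst r c => State p.+1 (upd M r c)
  | IAdd r a b => State p.+1 (upd M r (M a + M b))
  | ISub r a b => State p.+1 (upd M r (M a - M b))
  | ILoad r a => State p.+1 (upd M r (M (M a)))
  | IStore a r => State p.+1 (upd M (M a) (M r))
  | IJz r j => State (if M r == 0 then j else p.+1) M
  end.

Definition halted (prog : program) (s : state) : bool := size prog <= pc s.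

Definition step (prog : program) (s : state) : state :=
  match onth prog (pc s) with
  | Some ins => exec_instr s ins
  | None => s
  end.

Definition init_state (input : seq nat) : state :=
  State 0 (fun x => if x is x'.+1 then nth 0 input x' else size input).

(* Input size in bits (each entry costs its binary length, at least 1). *)
Definition input_size (input : seq nat) : nat :=
  \sum_(x <- input) (trunc_log 2 x).+1.

Definition decides_in (prog : program) (input : seq nat) (k : nat) (P : Prop) :
  Prop :=
  let s := iter k (step prog) (init_state input) in
  halted prog s /\ ((mem s 0 = 1 /\ P) \/ (mem s 0 = 0 /\ ~ P)).

(* Main.v *)
Require Import Defs.
From mathcomp Require Import all_boot all_order zify.
Set Implicit Arguments. Unset Strict Implicit. Unset Printing Implicit Defensive.

(* Since gamma = 1, a timestep is harmless if some project is disapproved by nobody,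
   and otherwise choosing a project there means charging exactly one agent.  Give
   each agent i slots 0, ..., l-1; charging i at timestep k uses a slot x with
   x < lambda for every constraint (t, lambda) with k < t.  Letting the j-th charge of
   an agent use slot j shows that an admissible outcome is the same thing as a
   matching of all the non-harmless ("needy") timesteps to slots.

   The matching is computed by an auction: an unmatched timestep takes a cheapest
   slot it may use, evicting the current owner, and the price of the slot goes up
   by one.  A timestep all of whose slots cost more than l refutes the existence of
   a matching, so every price stays at most l + 1 and the auction is polynomial.

   The auction is written in a small structured language whose only loop repeats
   its body a fixed number B of times, B being a multiple of the input length: its
   programs run in time O(B^d) for loop nesting depth d, whatever they compute. *)

(** * A structured language compiled to the RAM *)

Lemma updE M r v x : upd M r v x = if x == r then v else M x.
Proof. by []. Qed.

Definition straight (ins : instr) : bool := if ins is IJz _ _ then false else true.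

(** The program counter 0 is arbitrary: the effect of an instruction on the memory does not depend
    on it. *)
Definition exec_mem (M : nat -> nat) (ins : instr) : nat -> nat :=
  Defs.mem (exec_instr (State 0 M) ins).

Definition code_at (prog : program) (p : nat) (code : program) : Prop :=
  forall i, i < size code -> onth prog (p + i) = onth code i.

Lemma code_at_cat prog p c1 c2 :
  code_at prog p (c1 ++ c2) ->
  code_at prog p c1 /\ code_at prog (p + size c1) c2.
Proof.
move=> h; split=> i lti.
  by rewrite h ?size_cat ?onth_cat ?lti // ltn_addr.
by rewrite -addnA h ?size_cat ?ltn_add2l // onth_cat ltnNge leq_addr /= addKn.
Qed.

Lemma code_at_cons prog p ins c :
  code_at prog p (ins :: c) ->
  onth prog p = Some ins /\ code_at prog p.+1 c.
Proof.
move=> h; split; first by have := h 0 isT; rewrite addn0.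
by move=> i lti; rewrite addSnnS h.
Qed.

Lemma step_at prog p M ins :
  onth prog p = Some ins -> step prog (State p M) = exec_instr (State p M) ins.
Proof. by rewrite /step /= => ->. Qed.

Lemma straight_run prog code p M :
  code_at prog p code -> all straight code ->
  iter (size code) (step prog) (State p M) =
    State (p + size code) (foldl exec_mem M code).
Proof.
elim: code p M => [|ins code IH] p M /=; first by rewrite addn0.
move=> /code_at_cons[hi hc] /andP[sti stc].
rewrite -iterS iterSr (step_at _ hi).
have -> : exec_instr (State p M) ins = State p.+1 (exec_mem M ins) by case: ins sti {hi}.
by rewrite IH // addSnnS.
Qed.

(** * Syntax, semantics and compilation of structured programs *)

Inductive expr : Type :=
  | EVar of nat
  | ECst of nat
  | EBound
  | EAdd of expr & expr
  | ESub of expr & expr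
  | EGet of expr.

Inductive cmd : Type :=
  | Skip
  | Assign of nat & expr
  | Put of expr & expr
  | Seq of cmd & cmd
  | If of expr & cmd & cmd
  | Rep of cmd.

Record store := Store { vars : nat -> nat; heap : nat -> nat }.

Fixpoint eval (B : nat) (s : store) (e : expr) : nat :=
  match e with
  | EVar x => vars s x
  | ECst c => c
  | EBound => B
  | EAdd a b => eval B s a + eval B s b
  | ESub a b => eval B s a - eval B s b
  | EGet a => heap s (eval B s a)
  end.

Fixpoint run (B : nat) (c : cmd) (s : store) : store :=
  match c with
  | Skip => s
  | Assign x e => Store (upd (vars s) x (eval B s e)) (heap s)
  | Put a e => Store (vars s) (upd (heap s) (eval B s a) (eval B s e))
  | Seq c1 c2 => run B c2 (run B c1 s)
  | If e c1 c2 => if eval B s e == 0 then run B c2 s else run B c1 s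
  | Rep c => iter B (run B c) s
  end.

(* Registers: 0-19 hold the variables, 20 the bound B, 21-29 the loop counters
   (by nesting depth), 30-39 the expression stack; heap cell a is register 40 + a. *)
Fixpoint ecode (d : nat) (e : expr) : program :=
  match e with
  | EVar x => [:: IConst (30 + d) 0; IAdd (30 + d) (30 + d) x]
  | ECst c => [:: IConst (30 + d) c]
  | EBound => [:: IConst (30 + d) 0; IAdd (30 + d) (30 + d) 20]
  | EAdd a b => ecode d a ++ ecode d.+1 b ++ [:: IAdd (30 + d) (30 + d) (31 + d)]
  | ESub a b => ecode d a ++ ecode d.+1 b ++ [:: ISub (30 + d) (30 + d) (31 + d)]
  | EGet a => ecode d a ++ [:: IConst (31 + d) 40;
                               IAdd (30 + d) (30 + d) (31 + d);
                               ILoad (30 + d) (30 + d)]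
  end.

Fixpoint wf_expr (d : nat) (e : expr) : bool :=
  match e with
  | EVar x => (x < 20) && (d < 10)
  | ECst _ | EBound => d < 10
  | EAdd a b | ESub a b => [&& wf_expr d a, wf_expr d.+1 b & d < 9]
  | EGet a => wf_expr d a && (d < 9)
  end.

Fixpoint ccode (d p : nat) (c : cmd) : program :=
  match c with
  | Skip => [::]
  | Assign x e => ecode 0 e ++ [:: IConst 31 0; IAdd x 30 31]
  | Put a e => ecode 0 a ++ ecode 1 e ++
      [:: IConst 32 40; IAdd 30 30 32; IStore 30 31]
  | Seq c1 c2 =>
      let k1 := ccode d p c1 in k1 ++ ccode d (p + size k1) c2
  | If e c1 c2 =>
      let ke := ecode 0 e in
      let k1 := ccode d (p + size ke).+1 c1 in
      let p2 := ((p + size ke).+1 + size k1).+2 in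
      let k2 := ccode d p2 c2 in
      ke ++ IJz 30 p2 :: k1 ++ IConst 30 0 :: IJz 30 (p2 + size k2) :: k2
  | Rep c1 =>
      let k1 := ccode d.+1 p.+3 c1 in
      [:: IConst (21 + d) 0, IAdd (21 + d) (21 + d) 20,
          IJz (21 + d) (p.+3 + size k1).+4 &
          k1 ++ [:: IConst 30 1; ISub (21 + d) (21 + d) 30;
                    IConst 30 0; IJz 30 p.+2]]
  end.

Fixpoint wf_cmd (d : nat) (c : cmd) : bool :=
  match c with
  | Skip => true
  | Assign x e => (x < 20) && wf_expr 0 e
  | Put a e => wf_expr 0 a && wf_expr 1 e
  | Seq c1 c2 => wf_cmd d c1 && wf_cmd d c2
  | If e c1 c2 => [&& wf_expr 0 e, wf_cmd d c1 & wf_cmd d c2]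
  | Rep c1 => (d < 9) && wf_cmd d.+1 c1
  end.

(** Both branches of [If] are counted, so this bound on the number of RAM steps depends on [B] and
    the program but not on the store. *)
Fixpoint cost (B : nat) (c : cmd) : nat :=
  match c with
  | Skip => 0
  | Assign _ e => (size (ecode 0 e)).+2
  | Put a e => (size (ecode 0 a) + size (ecode 1 e)).+3
  | Seq c1 c2 => cost B c1 + cost B c2
  | If e c1 c2 => size (ecode 0 e) + (cost B c1 + cost B c2).+3
  | Rep c1 => B * (cost B c1 + 5) + 3
  end.

Definition simulates (B : nat) (s : store) (M : nat -> nat) : Prop :=
  [/\ forall x, x < 20 -> M x = vars s x,
      M 20 = B & forall a, M (40 + a) = heap s a].

Lemma ecode_straight d e : all straight (ecode d e).
Proof.
by elim: e d => //= [a IHa b IHb|a IHa b IHb|a IHa] d;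
  rewrite !all_cat ?IHa ?IHb.
Qed.

(** The frame clause drives the induction: code at stack level [d] changes only registers [30 + d]
    to 39, so a left operand survives the evaluation of the right one, a level higher. *)
Lemma ecodeP B s M d e : simulates B s M -> wf_expr d e ->
  let M' := foldl exec_mem M (ecode d e) in
  M' (30 + d) = eval B s e /\
  (forall x, (x < 30 + d) || (40 <= x) -> M' x = M x).
Proof.
elim: e d M => [x|c||a IHa b IHb|a IHa b IHb|a IHa] d M [hv hb hh] /=.
- case/andP=> ltx ltd; rewrite /exec_mem /= !updE !eqxx.
  have -> : (x == 30 + d) = false by lia.
  split; first by rewrite hv.
  by move=> y hy; rewrite !updE; have -> : (y == 30 + d) = false by lia.
- move=> ltd; rewrite /exec_mem /= updE eqxx; split=> // y hy.
  by rewrite !updE; have -> : (y == 30 + d) = false by lia.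
- move=> ltd; rewrite /exec_mem /= !updE !eqxx.
  have -> : (20 == 30 + d) = false by lia.
  split; first by rewrite hb.
  by move=> y hy; rewrite !updE; have -> : (y == 30 + d) = false by lia.
- case/and3P=> wa wb ltd; rewrite !foldl_cat.
  have [va fa] := IHa d M (And3 hv hb hh) wa.
  set Ma := foldl _ _ _ in va fa *.
  have sa : simulates B s Ma.
    by split=> [x ltx||y]; rewrite fa ?hb ?hh ?hv //; lia.
  have [vb fb] := IHb d.+1 Ma sa wb.
  set Mb := foldl _ _ _ in vb fb *.
  rewrite /= /exec_mem /= !updE eqxx fb ?va; last lia.
  rewrite -vb addnS; split=> // y hy; rewrite updE.
  have -> : (y == 30 + d) = false by lia.
  by rewrite fb ?fa //; lia.
- case/and3P=> wa wb ltd; rewrite !foldl_cat.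
  have [va fa] := IHa d M (And3 hv hb hh) wa.
  set Ma := foldl _ _ _ in va fa *.
  have sa : simulates B s Ma.
    by split=> [x ltx||y]; rewrite fa ?hb ?hh ?hv //; lia.
  have [vb fb] := IHb d.+1 Ma sa wb.
  set Mb := foldl _ _ _ in vb fb *.
  rewrite /= /exec_mem /= !updE eqxx fb ?va; last lia.
  rewrite -vb addnS; split=> // y hy; rewrite updE.
  have -> : (y == 30 + d) = false by lia.
  by rewrite fb ?fa //; lia.
- case/andP=> wa ltd; rewrite foldl_cat.
  have [va fa] := IHa d M (And3 hv hb hh) wa.
  set Ma := foldl _ _ _ in va fa *.
  rewrite /= /exec_mem /= !updE !eqxx.
  have -> : (30 + d == 31 + d) = false by lia.
  rewrite va; split.
    rewrite addnC.
    have -> : (40 + eval B s a == 30 + d) = false by lia.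
    have -> : (40 + eval B s a == 31 + d) = false by lia.
    by rewrite fa ?hh //; lia.
  move=> y hy; rewrite !updE.
  have -> : (y == 30 + d) = false by lia.
  have -> : (y == 31 + d) = false by lia.
  by rewrite fa //; lia.
Qed.

Lemma ecode_run B s prog p M d e :
  simulates B s M -> wf_expr d e -> code_at prog p (ecode d e) ->
  exists M', [/\ iter (size (ecode d e)) (step prog) (State p M) =
                   State (p + size (ecode d e)) M',
                 M' (30 + d) = eval B s e &
                 forall x, (x < 30 + d) || (40 <= x) -> M' x = M x].
Proof.
move=> hs hw hc; have [h1 h2] := ecodeP hs hw.
exists (foldl exec_mem M (ecode d e)); split=> //.
exact: straight_run hc (ecode_straight d e).
Qed.

Lemma simulates_frame B s M M' :
  simulates B s M -> (forall x, (x < 21) || (40 <= x) -> M' x = M x) ->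
  simulates B s M'.
Proof. by case=> hv hb hh h; split=> [x hx||a]; rewrite h ?hb ?hh ?hv //; lia. Qed.

(** Induction on [c]. The number of steps is existential because branches differ in length. The last
    clause protects the counters of the enclosing loops, so that these can resume after their
    body. *)
Lemma ccode_run B prog c d p s M :
  wf_cmd d c -> code_at prog p (ccode d p c) -> simulates B s M ->
  exists t M', [/\ t <= cost B c,
    iter t (step prog) (State p M) = State (p + size (ccode d p c)) M',
    simulates B (run B c s) M' &
    forall j, j < d -> j < 9 -> M' (21 + j) = M (21 + j)].
Proof.
elim: c d p s M => [|x e|a e|c1 IH1 c2 IH2|e c1 IH1 c2 IH2|c IH] d p s M /=.
- by move=> _ _ hs; exists 0, M; rewrite addn0.
- case/andP=> ltx we /code_at_cat[he hc] hs.
  have [M1 [r1 v1 f1]] := ecode_run hs we he.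
  have {}hs := simulates_frame hs (M' := M1).
  (* There is no move instruction: register 30 is copied by adding register 31, which has been set
     to 0. *)
  exists ((size (ecode 0 e)).+2), (upd (upd M1 31 0) x (M1 30 + 0)); split=> //.
  + rewrite 2!iterS r1.
    by have := straight_run M1 hc isT; rewrite /= => ->; rewrite size_cat addnA.
  + case: (hs _) => [y hy|hv hb hh]; first by rewrite f1 //; lia.
    split=> [y lty||a] /=; rewrite !updE.
    * by rewrite v1 addn0 hv //; have -> : (y == 31) = false by lia.
    * have -> : (20 == x) = false by lia.
      by rewrite /= hb.
    * have -> : (40 + a == x) = false by lia.
      by have -> : (40 + a == 31) = false by lia.
  + move=> j _ ltj; rewrite !updE.
    have -> : (21 + j == x) = false by lia.
    have -> : (21 + j == 31) = false by lia.
    by rewrite f1 //; lia.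
- case/andP=> wa we /code_at_cat[ha /code_at_cat[he hc]] hs.
  have [M1 [r1 v1 f1]] := ecode_run hs wa ha.
  have hs1 : simulates B s M1 by apply: simulates_frame hs _ => y hy; rewrite f1 //; lia.
  have [M2 [r2 v2 f2]] := ecode_run hs1 we he.
  have hs2 : simulates B s M2 by apply: simulates_frame hs1 _ => y hy; rewrite f2 //; lia.
  exists ((size (ecode 0 a) + size (ecode 1 e)).+3).
  eexists; split; first by [].
  + rewrite 3!iterS addnC iterD r1 r2.
    by have := straight_run M2 hc isT; rewrite /= => ->; rewrite !size_cat !addnA.
  + have m30 : M2 30 = eval B s a by rewrite f2.
    have [hv hb hh] := hs2.
    split=> [y lty||b]; rewrite /= /exec_mem /= !updE /= m30.
    * have -> : (y == eval B s a + 40) = false by lia.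
      have -> : (y == 30) = false by lia.
      have -> : (y == 32) = false by lia.
      by rewrite hv.
    * have -> : (20 == eval B s a + 40) = false by lia.
      by rewrite hb.
    * rewrite -[31]/(30 + 1) v2.
      have -> : (40 + b == eval B s a + 40) = (b == eval B s a) by lia.
      by rewrite -hh.
  + move=> j _ ltj; rewrite /= /exec_mem /= !updE.
    have -> : (21 + j == 30) = false by lia.
    have -> : (21 + j == 32) = false by lia.
    rewrite ifF; last by rewrite /=; lia.
    by rewrite f2 ?f1 //; lia.
- case/andP=> w1 w2 /code_at_cat[h1 h2] hs.
  have [t1 [M1 [l1 r1 s1 f1]]] := IH1 _ _ _ _ w1 h1 hs.
  have [t2 [M2 [l2 r2 s2 f2]]] := IH2 _ _ _ _ w2 h2 s1.
  exists (t2 + t1), M2; split=> //; first by lia.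
    by rewrite iterD r1 r2 size_cat addnA.
  by move=> j jd j9; rewrite f2 ?f1.
- case/and3P=> we w1 w2 /code_at_cat[he /code_at_cons[hj /code_at_cat[h1]]].
  case/code_at_cons=> hz /code_at_cons[hz' h2] hs.
  have [M0 [r0 v0 f0]] := ecode_run hs we he.
  have hs0 : simulates B s M0 by apply: simulates_frame hs _ => y hy; rewrite f0 //; lia.
  set ke := ecode 0 e in he hj h1 hz hz' h2 r0 *.
  set k1 := ccode d (p + size ke).+1 c1 in h1 hj hz hz' h2 *.
  set p2 := (((p + size ke).+1 + size k1).+2) in hj hz hz' h2 *.
  set k2 := ccode d p2 c2 in h2 hz' *.
  have st0 : step prog (State (p + size ke) M0) =
      State (if eval B s e == 0 then p2 else (p + size ke).+1) M0.
    by rewrite (step_at _ hj) /= -v0.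
  have szE : p + size (ke ++ IJz 30 p2 :: k1 ++
      [:: IConst 30 0, IJz 30 (p2 + size k2) & k2]) = p2 + size k2.
    by rewrite !size_cat /= !size_cat /= /p2; lia.
  case: ifP st0 => e0 st0.
    have [t2 [M2 [l2 r2 s2 f2]]] := IH2 _ _ _ _ w2 h2 hs0.
    exists (t2 + (size ke).+1), M2; split=> //; first lia.
      by rewrite iterD iterS r0 st0 r2 szE.
    by move=> j jd j9; rewrite f2 ?f0 //; lia.
  have [t1 [M1 [l1 r1 s1 f1]]] := IH1 _ _ _ _ w1 h1 hs0.
  exists ((t1 + (size ke).+1).+2), (upd M1 30 0); split=> //.
  + lia.
  + rewrite !iterS iterD iterS r0 st0 r1 (step_at _ hz) /= (step_at _ hz') /=.
    by rewrite szE.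
  + by apply: simulates_frame s1 _ => y hy; rewrite updE ifF //; lia.
  + move=> j jd j9; rewrite updE ifF; last lia.
    by rewrite f1 ?f0 //; lia.
- case/andP=> d9 wc /code_at_cons[h1 /code_at_cons[h2 /code_at_cons[h3]]].
  set k1 := ccode d.+1 p.+3 c in h3 *.
  case/code_at_cat=> hc hend hs.
  set q := (p.+3 + size k1).+4 in h3 *.
  have szE : p + (size (k1 ++ [:: IConst 30 1; ISub (21 + d) (21 + d) 30;
                    IConst 30 0; IJz 30 p.+2])).+3 = q.
    by rewrite size_cat /= /q; lia.
  (* Register [21 + d] holds the number [k] of passes left. A pass costs one step for the test at
     [p.+2], the body, and four steps to decrement and jump back; the extra 1 is the test that
     leaves the loop. *)
  have loop k s' M0 : simulates B s' M0 -> M0 (21 + d) = k ->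
     exists t M', [/\ t <= k * (cost B c + 5) + 1,
       iter t (step prog) (State p.+2 M0) = State q M',
       simulates B (iter k (run B c) s') M' &
       forall j, j < d -> j < 9 -> M' (21 + j) = M0 (21 + j)].
    elim: k s' M0 => [|k IHk] s' M0 hs' hk.
      by exists 1, M0; split=> //=; rewrite (step_at _ h3) /= hk.
    have [t1 [M1 [l1 r1 s1 f1]]] := IH _ _ _ _ wc hc hs'.
    have c1 : M1 (21 + d) = k.+1 by rewrite f1.
    have hM2 : exists M2, [/\ iter 4 (step prog) (State (p.+3 + size k1) M1) = State p.+2 M2,
       M2 (21 + d) = k, simulates B (run B c s') M2 &
       forall j, j < d -> j < 9 -> M2 (21 + j) = M1 (21 + j)].
      case/code_at_cons: hend => g1 /code_at_cons[g2 /code_at_cons[g3 /code_at_cons[g4 _]]].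
      rewrite /= (step_at _ g1) /= (step_at _ g2) /= (step_at _ g3) /= (step_at _ g4) /=.
      have e1 : (21 + d == 30) = false by lia.
      eexists; split; first reflexivity.
      + by rewrite !updE e1 !eqxx c1; lia.
      + apply: simulates_frame s1 _ => y hy; rewrite !updE.
        have -> : (y == 30) = false by lia.
        by have -> : (y == 21 + d) = false by lia.
      + move=> j jd j9; rewrite !updE.
        have -> : (21 + j == 30) = false by lia.
        by have -> : (21 + j == 21 + d) = false by lia.
    have [M2 [r2 c2 s2 f2]] := hM2.
    have [t3 [M3 [l3 r3 s3 f3]]] := IHk _ _ s2 c2.
    exists (t3 + (4 + (t1 + 1))), M3; split.
    + lia.
    + rewrite iterD iterD iterD [iter 1 _ _]/= (step_at _ h3) /= hk /=.
      by rewrite r1 /= -[step _ (step _ (step _ (step _ _)))]/(iter 4 (step prog) _) r2.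
    + by rewrite iterSr.
    + move=> j jd j9; rewrite f3 ?f2 ?f1 //; lia.
  have [hv hb hh] := hs.
  have e1 : (20 == 21 + d) = false by lia.
  have := loop B s (upd (upd M (21 + d) 0) (21 + d) (0 + B)).
  case.
  + apply: simulates_frame hs _ => y hy; rewrite !updE.
    by have -> : (y == 21 + d) = false by lia.
  + by rewrite updE eqxx.
  move=> t [M' [lt rt st ft]]; exists (t + 2), M'; split=> //.
  + by lia.
  + rewrite iterD /= (step_at _ h1) /= (step_at _ h2) /= !updE eqxx e1 hb.
    by rewrite rt szE.
  + move=> j jd j9; rewrite ft // !updE.
    by have -> : (21 + j == 21 + d) = false by lia.
Qed.

(** * Running time of structured programs *)

Fixpoint weight (c : cmd) : nat :=
  match c with
  | Skip => 0
  | Assign _ e => (size (ecode 0 e)).+2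
  | Put a e => (size (ecode 0 a) + size (ecode 1 e)).+3
  | Seq c1 c2 => weight c1 + weight c2
  | If e c1 c2 => size (ecode 0 e) + (weight c1 + weight c2).+3
  | Rep c1 => weight c1 + 8
  end.

Fixpoint depth (c : cmd) : nat :=
  match c with
  | Seq c1 c2 | If _ c1 c2 => maxn (depth c1) (depth c2)
  | Rep c1 => (depth c1).+1
  | _ => 0
  end.

(** Each [Rep] contributes a factor [B], and its overhead [5 * B + 3] is absorbed by the 8 in
    [weight]. The base [B.+1] is positive, which makes powers monotone in the depth. *)
Lemma cost_bound B c : cost B c <= weight c * B.+1 ^ depth c.
Proof.
have mono w d d' : d <= d' -> w * B.+1 ^ d <= w * B.+1 ^ d'.
  by move=> h; rewrite leq_mul2l leq_pexp2l ?orbT.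
have pos d : 0 < B.+1 ^ d by rewrite expn_gt0.
elim: c => [|x e|a e|c1 IH1 c2 IH2|e c1 IH1 c2 IH2|c IH] //=; rewrite ?expn0 ?muln1 //.
- rewrite mulnDl leq_add //.
    exact: leq_trans IH1 (mono _ _ _ (leq_maxl _ _)).
  exact: leq_trans IH2 (mono _ _ _ (leq_maxr _ _)).
- have l1 := leq_trans IH1 (mono _ _ _ (leq_maxl _ (depth c2))).
  have l2 := leq_trans IH2 (mono _ _ _ (leq_maxr (depth c1) _)).
  have := pos (maxn (depth c1) (depth c2)); move: (_ ^ _) l1 l2 => X; nia.
- rewrite expnS; have := pos (depth c); move: (_ ^ _) IH => X; nia.
Qed.

(** * The auction *)

Definition matchable (L : nat) (need : nat -> Prop) (adj : nat -> nat -> Prop) :=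
  exists f : nat -> nat,
    (forall k, k < L -> need k -> adj k (f k)) /\
    (forall k k', k < L -> k' < L -> need k -> need k' -> f k = f k' -> k = k').

(** [L] bidders compete for [NR] objects. [owner_cheap] is the approximate complementary slackness
    of auction algorithms, with increment 1. [assigned_owns] is restricted to bidders with [need],
    since the others are flagged without owning anything. *)
Record auction_inv (L NR : nat) (need : nat -> Prop) (adj : nat -> nat -> Prop)
    (price owner assigned : nat -> nat) : Prop := AuctionInv {
  owner_valid : forall r, r < NR -> owner r != 0 ->
    [/\ owner r <= L, need (owner r).-1, adj (owner r).-1 r & assigned (owner r) != 0];
  owner_cheap : forall r r', r < NR -> owner r != 0 -> r' < NR ->
    adj (owner r).-1 r' -> price r <= (price r').+1;
  owner_inj : forall r r', r < NR -> r' < NR -> owner r != 0 ->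
    owner r = owner r' -> r = r';
  assigned_owns : forall k, k < L -> need k -> assigned k.+1 != 0 ->
    exists2 r, r < NR & owner r = k.+1;
  priced_owned : forall r, r < NR -> price r != 0 -> owner r != 0;
  price_le : forall r, r < NR -> price r <= L.+1 }.

(** [b] is the minimum of the cap [c] and the prices on [P]; the witness [r0] is meaningful only
    when some price beats the cap. *)
Definition cheapest (c : nat) (price : nat -> nat) (P : nat -> Prop) (b r0 : nat) :=
  [/\ b <= c, forall r, P r -> b <= price r & b < c -> P r0 /\ price r0 = b].

Lemma cheapest_ext c price P P' b r0 :
  (forall r, P r <-> P' r) -> cheapest c price P b r0 -> cheapest c price P' b r0.
Proof.
move=> e [h1 h2 h3]; split=> // [r /e|/h3 []]; first exact: h2.
by move=> /e.
Qed.

Lemma cheapest_keep c price P b r0 r1 :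
  cheapest c price P b r0 -> b <= price r1 ->
  cheapest c price (fun r => P r \/ r = r1) b r0.
Proof.
by case=> h1 h2 h3 h; split=> // [r [/h2//|->//]|/h3[]]; split; [left|].
Qed.

Lemma cheapest_switch c price P b r0 r1 :
  cheapest c price P b r0 -> price r1 < b ->
  cheapest c price (fun r => P r \/ r = r1) (price r1) r1.
Proof.
case=> h1 h2 h3 h; split=> [|r [/h2|->//]|_]; try lia.
Qed.

(* With R_j the objects of price at least j and K_j their owners together with
   the stuck bidder k0, the neighbours of K_j lie in R_(j-1) while #|K_j| = #|R_j| + 1:
   a matching would make the R_j grow L times, to more objects than bidders. *)
Lemma stuck_not_matchable L NR need adj price owner assigned k0 :
  (forall k r, k < L -> adj k r -> r < NR) ->
  auction_inv L NR need adj price owner assigned ->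
  k0 < L -> need k0 -> assigned k0.+1 = 0 ->
  (forall r, adj k0 r -> L < price r) -> ~ matchable L need adj.
Proof.
move=> adj_lt I ltk0 nk0 as0 dear [f [fadj finj]].
have ltr0 : f k0 < NR by apply: (adj_lt _ _ ltk0); exact: fadj.
pose k0' : 'I_L := Ordinal ltk0; pose r0 : 'I_NR := Ordinal ltr0.
pose R j := [set r : 'I_NR | j <= price r].
pose K j := [set k : 'I_L | (k == k0') || [exists r : 'I_NR, (r \in R j) && (owner r == k.+1)]].
have gE j (r : 'I_NR) : 0 < j -> r \in R j ->
    owner r != 0 /\ val (insubd k0' (owner r).-1) = (owner r).-1.
  move=> j0; rewrite inE => jr.
  have o0 : owner r != 0 by apply: (priced_owned I) => //; lia.
  split=> //; rewrite val_insubd.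
  have [oL _ _ _] := owner_valid I (ltn_ord r) o0.
  by have -> : (owner r).-1 < L by lia.
(* The objects in [R j] have distinct owners, and [k0] is not among them because its flag is 0. *)
have RK j : 0 < j -> #|R j| < #|K j|.
  move=> j0; pose g (r : 'I_NR) := insubd k0' (owner r).-1.
  have ginj : {in R j &, injective g}.
    move=> r r' rR r'R /(congr1 val).
    have [o1 ->] := gE j r j0 rR; have [o2 ->] := gE j r' j0 r'R.
    move=> e; have e2 : owner r = owner r' by lia.
    exact/val_inj/(owner_inj I (ltn_ord r) (ltn_ord r') o1 e2).
  rewrite -(card_in_imset ginj).
  have k0N : k0' \notin g @: R j.
    apply/imsetP=> -[r rR /(congr1 val)]; have [o1 ->] := gE j r j0 rR.
    move=> /= e; have [_ _ _] := owner_valid I (ltn_ord r) o1.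
    by rewrite -(prednK (n := owner r)) ?lt0n // -e as0.
  suff : #|k0' |: g @: R j| <= #|K j| by rewrite cardsU1 k0N.
  apply/subset_leq_card/subsetP=> k; rewrite !inE => /orP[->//|/imsetP[r rR ->]].
  apply/orP; right; apply/existsP; exists r; rewrite rR /=.
  by have [o1 ->] := gE j r j0 rR; rewrite prednK ?lt0n.
(* The matching sends [K j.+1] injectively into [R j]: all objects open to [k0] cost more than [L],
   and [owner_cheap] leaves the other members no alternative cheaper than [j]. *)
have KR j : j <= L -> #|K j.+1| <= #|R j|.
  move=> jL; pose f' (k : 'I_L) := insubd r0 (f k).
  have Kneed (k : 'I_L) : k \in K j.+1 -> need k.
    rewrite inE => /orP[/eqP->//|/existsP[r /andP[rR /eqP e]]].
    have [o1 _] := gE j.+1 r isT rR.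
    by have [_] := owner_valid I (ltn_ord r) o1; rewrite e.
  have f'E k : k \in K j.+1 -> val (f' k) = f k.
    move=> kK; have ka := fadj _ (ltn_ord k) (Kneed k kK).
    by rewrite val_insubd (adj_lt _ _ (ltn_ord k) ka).
  have f'inj : {in K j.+1 &, injective f'}.
    move=> k k' kK k'K /(congr1 val); rewrite !f'E // => e.
    apply: val_inj; exact: finj (ltn_ord k) (ltn_ord k') (Kneed k kK) (Kneed k' k'K) e.
  rewrite -(card_in_imset f'inj); apply/subset_leq_card/subsetP=> r /imsetP[k kK ->].
  rewrite inE f'E //.
  have ka := fadj _ (ltn_ord k) (Kneed k kK).
  have fk := adj_lt _ _ (ltn_ord k) ka.
  move: kK; rewrite inE => /orP[/eqP ek|/existsP[r' /andP[rR /eqP e]]].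
    by move: ka; rewrite ek => /dear /ltnW; exact: leq_trans.
  have [o1 _] := gE j.+1 r' isT rR.
  have := owner_cheap I (ltn_ord r') o1 fk; rewrite e => /(_ ka).
  by move: rR; rewrite inE; lia.
(* Alternating both inequalities gains one object per price level; [R 1] then has at least [L]
   objects and [K 1] more than [L] bidders, which is absurd. *)
have grow d : d <= L -> d <= #|R (L.+1 - d)|.
  elim: d => // d IHd dL.
  have -> : L.+1 - d.+1 = L - d by lia.
  apply: leq_trans (KR _ (leq_subr _ _)).
  have -> : (L - d).+1 = L.+1 - d by lia.
  by apply: leq_ltn_trans (RK _ _); [apply: IHd; lia | lia].
have := leq_ltn_trans (grow L (leqnn _)) (RK (L.+1 - L) _).
rewrite subSnn => /(_ isT); have := max_card (K 1); rewrite card_ord; lia.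
Qed.

(** The matching is read off the owners and is injective because an object stores a single owner.
    Among the bidders, the default 0 can arise only for those without [need]. *)
Lemma assigned_matchable L NR need adj price owner assigned :
  auction_inv L NR need adj price owner assigned ->
  (forall k, k < L -> assigned k.+1 != 0) -> matchable L need adj.
Proof.
move=> I done.
have ownP k : k < L -> need k -> exists r : 'I_NR, owner r == k.+1.
  move=> kL kn; have [r rN e] := assigned_owns I kL kn (done k kL).
  by exists (Ordinal rN); rewrite /= e.
exists (fun k => if [pick r : 'I_NR | owner r == k.+1] is Some r then val r else 0).
split=> [k kL kn|k k' kL k'L kn k'n].
  case: pickP => [r /eqP e|h]; last by have [r] := ownP k kL kn; rewrite h.
  by have [] := owner_valid I (ltn_ord r); rewrite e.
case: pickP => [r /eqP e|h]; last by have [r] := ownP k kL kn; rewrite h.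
case: pickP => [r' /eqP e'|h]; last by have [r'] := ownP k' k'L k'n; rewrite h.
by move=> /val_inj er; move: e e'; rewrite er => -> [].
Qed.

(** The old price of [r0] was minimal for [k] and rises by one, which gives [owner_cheap] for the
    new owner; for the others it persists since prices only rise. If [r0] was unowned, the flag
    cleared is the dummy one. *)
Lemma auction_bid L NR (need : nat -> Prop) adj price owner assigned
    price' owner' assigned' k b r0 :
  (forall k r, k < L -> adj k r -> r < NR) ->
  auction_inv L NR need adj price owner assigned ->
  k < L -> need k -> assigned k.+1 = 0 ->
  cheapest L.+1 price (adj k) b r0 -> b < L.+1 ->
  (forall r, r < NR -> price' r = if r == r0 then b.+1 else price r) ->
  (forall r, r < NR -> owner' r = if r == r0 then k.+1 else owner r) ->
  (forall j, j <= L -> assigned' j =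
     if j == k.+1 then 1 else if j == owner r0 then 0 else assigned j) ->
  auction_inv L NR need adj price' owner' assigned'.
Proof.
move=> adj_lt I kL kn ak [_ cmin /[swap] bL /(_ bL)[ar0 pr0] pE oE aE].
have r0N := adj_lt _ _ kL ar0.
have mono r : r < NR -> price r <= price' r.
  by move=> rN; rewrite pE //; case: eqP => // ->; lia.
(* Bidder [k] owns nothing yet, its flag being 0, so it cannot end up with two objects. *)
have ow r : r < NR -> owner r != k.+1.
  move=> rN; apply/negP=> /eqP e.
  by have [] := owner_valid I rN; rewrite e // ak.
split.
- move=> r rN; rewrite oE //; case: (r =P r0) => [-> _|/eqP nr o0].
    by split; rewrite ?aE ?eqxx //.
  have [oL on oa os] := owner_valid I rN o0; split=> //.
  rewrite aE // (negPf (ow r rN)); case: (owner r =P owner r0) => // e.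
  by case/eqP: nr; apply: (owner_inj I).
- move=> r r' rN; rewrite oE // pE //; case: (r =P r0) => [_ _|/eqP nr o0] r'N /= ar'.
    exact: leq_trans (cmin _ ar') (mono _ r'N).
  by have := owner_cheap I rN o0 r'N ar'; have := mono _ r'N; lia.
- move=> r r' rN r'N; rewrite !oE //; case: (r =P r0) => [->|_]; case: (r' =P r0) => [->//|_] //.
  + by move=> _ e; have := ow r' r'N; rewrite -e eqxx.
  + by move=> _ e; have := ow r rN; rewrite e eqxx.
  + exact: (owner_inj I).
- move=> k' k'L k'n; rewrite aE //; case: (k'.+1 =P k.+1) => [[->] _|/eqP nk].
    by exists r0; rewrite // oE // eqxx.
  case: (k'.+1 =P owner r0) => // no as'.
  have [r rN e] := assigned_owns I k'L k'n as'.
  exists r => //; rewrite oE //; case: (r =P r0) => // er; case: no; by rewrite -er e.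
- move=> r rN; rewrite pE // oE //; case: (r =P r0) => // _; exact: (priced_owned I).
- move=> r rN; rewrite pE //; case: (r =P r0) => // _; exact: (price_le I).
Qed.

Lemma auction_free L NR (need : nat -> Prop) adj price owner assigned assigned' k :
  auction_inv L NR need adj price owner assigned ->
  ~ need k ->
  (forall j, j <= L -> assigned' j = if j == k.+1 then 1 else assigned j) ->
  auction_inv L NR need adj price owner assigned'.
Proof.
case=> h1 h2 h3 h4 h5 h6 kn aE; split=> //.
- move=> r rN o0; have [? ? ? h] := h1 r rN o0; split=> //.
  by rewrite aE //; case: (owner r =P k.+1).
- move=> k' k'L k'n; rewrite aE //; case: (k'.+1 =P k.+1) => [[e] _|_]; last exact: h4.
  by case: kn; rewrite -e.
Qed.

Lemma auction_init L NR need adj price owner assigned :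
  (forall r, r < NR -> price r = 0) -> (forall r, r < NR -> owner r = 0) ->
  (forall k, k < L -> assigned k.+1 = 0) ->
  auction_inv L NR need adj price owner assigned.
Proof.
move=> p0 o0 a0; split.
- by move=> r rN; rewrite o0.
- by move=> r r' rN; rewrite o0.
- by move=> r r' rN _; rewrite o0.
- by move=> k kL _; rewrite a0.
- by move=> r rN; rewrite p0.
- by move=> r rN; rewrite p0.
Qed.

(** * Reasoning about structured programs *)

(** [writes] and [pure] are syntactic, so the frame conditions of a concrete program hold by
    computation. *)
Fixpoint writes (c : cmd) : seq nat :=
  match c with
  | Assign x _ => [:: x]
  | Seq c1 c2 | If _ c1 c2 => writes c1 ++ writes c2
  | Rep c => writes c
  | _ => [::]
  end.

Fixpoint pure (c : cmd) : bool :=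
  match c with
  | Put _ _ => false
  | Seq c1 c2 | If _ c1 c2 => pure c1 && pure c2
  | Rep c => pure c
  | _ => true
  end.

Lemma run_vars B c s x : x \notin writes c -> vars (run B c s) x = vars s x.
Proof.
elim: c s => //= [y e|c1 IH1 c2 IH2|e c1 IH1 c2 IH2|c IH] s.
- by rewrite inE => /negPf xy; rewrite /= updE xy.
- by rewrite mem_cat negb_or => /andP[h1 h2]; rewrite IH2 ?IH1.
- by rewrite mem_cat negb_or => /andP[h1 h2]; case: ifP => _; rewrite ?IH2 ?IH1.
- by move=> h; elim: {1}B => //= b IHb; rewrite IH.
Qed.

Lemma run_heap B c s : pure c -> heap (run B c s) = heap s.
Proof.
elim: c s => //= [c1 IH1 c2 IH2|e c1 IH1 c2 IH2|c IH] s.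
- by case/andP=> h1 h2; rewrite IH2 ?IH1.
- by case/andP=> h1 h2; case: ifP => _; rewrite ?IH2 ?IH1.
- by move=> h; elim: {1}B => //= b IHb; rewrite IH.
Qed.

Lemma run_If B e c1 c2 s :
  run B (If e c1 c2) s = if eval B s e == 0 then run B c2 s else run B c1 s.
Proof. by []. Qed.

Definition setv (s : store) (x v : nat) : store := Store (upd (vars s) x v) (heap s).

Lemma upd_neq M x v y : y != x -> upd M x v y = M y.
Proof. by move=> /negPf yx; rewrite updE yx. Qed.

(** [Rep] always makes [B] passes; the guard turns those after the first [y] into no-ops. *)
Definition For (x y : nat) (c : cmd) : cmd :=
  Seq (Assign x (ECst 0))
      (Rep (If (ESub (EVar y) (EVar x))
               (Seq c (Assign x (EAdd (EVar x) (ECst 1)))) Skip)).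

(** A Hoare-style rule whose step may assume the frame facts, so that an invariant need only mention
    what the body changes. *)
Lemma For_ind B x y c s (I : nat -> store -> Prop) :
  vars s y <= B -> [&& x != y, x \notin writes c & y \notin writes c] ->
  I 0 (setv s x 0) ->
  (forall j s', j < vars s y -> vars s' x = j ->
     (forall z, z \notin x :: writes c -> vars s' z = vars s z) ->
     (pure c -> heap s' = heap s) ->
     I j s' -> I j.+1 (setv (run B c s') x j.+1)) ->
  I (vars s y) (run B (For x y c) s).
Proof.
move=> yB /and3P[xy xc yc] I0 Istep.
pose J j s' := [/\ vars s' x = j,
   forall z, z \notin x :: writes c -> vars s' z = vars s z,
   pure c -> heap s' = heap s & I j s'].
rewrite /=; set s0 := Store _ _; set body := (fun s' => _).
have yin : y \notin x :: writes c by rewrite inE negb_or eq_sym xy.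
(* After [t] passes of [Rep], [minn t (vars s y)] of them have been effective. *)
suff H t : J (minn t (vars s y)) (iter t body s0).
  by have [_ _ _] := H B; rewrite (minn_idPr yB).
elim: t => [|t [h1 h2 h3 h4]] /=.
  rewrite min0n; split=> //; first by rewrite /= updE eqxx.
  by move=> z; rewrite inE negb_or => /andP[zx _]; rewrite /= updE (negPf zx).
move: h1 h2 h3 h4; set s' := iter t body s0 => h1 h2 h3 h4.
rewrite {1}/body h1 (h2 _ yin); case: ifP => hy.
  have e1 : minn t.+1 (vars s y) = vars s y by lia.
  have e2 : minn t (vars s y) = vars s y by lia.
  move: h1 h4; rewrite e1 e2 => h1 h4; split; [exact: h1|exact: h2|exact: h3|exact: h4].
have e1 : minn t.+1 (vars s y) = t.+1 by lia.
have e2 : minn t (vars s y) = t by lia.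
move: h1 h4; rewrite e1 e2 => h1 h4.
have -> : Store (upd (vars (run B c s')) x (vars (run B c s') x + 1)) (heap (run B c s')) = setv (run B c s') x t.+1.
  by rewrite run_vars // h1 addn1.
split.
- by rewrite /= updE eqxx.
- move=> z hz; rewrite /= updE; move: (hz); rewrite inE negb_or => /andP[/negPf-> zc].
  by rewrite run_vars // h2.
- by move=> pc; rewrite /= run_heap // h3.
- by apply: Istep => //; lia.
Qed.

Definition Mul (z x y t : nat) : cmd :=
  Seq (Assign z (ECst 0)) (For t x (Assign z (EAdd (EVar z) (EVar y)))).

Lemma run_Mul B z x y t s :
  uniq [:: z; x; y; t] -> vars s x <= B ->
  vars (run B (Mul z x y t) s) z = vars s x * vars s y.
Proof.
rewrite [uniq _]/= !inE !negb_or andbT => /andP[/and3P[zx zy zt] /andP[/andP[xy xt] yt]] xB.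
set s0 := setv s z 0.
have ex : vars s x = vars s0 x by rewrite /= updE eq_sym (negPf zx).
have ey : vars s y = vars s0 y by rewrite /= updE eq_sym (negPf zy).
rewrite ex ey.
rewrite -[run B _ s]/(run B (For t x (Assign z (EAdd (EVar z) (EVar y)))) s0).
apply: (For_ind
  (I := fun j s' => vars s' z = j * vars s0 y)).
- by rewrite -ex.
- by rewrite /= !inE eq_sym xt eq_sym zt eq_sym zx.
- by rewrite /= !updE (negPf zt) eqxx.
- move=> j s' _ _ fr _ h.
  rewrite /= !updE (negPf zt) eqxx h fr ?mulSn 1?addnC //.
  by rewrite !inE negb_or yt eq_sym zy.
Qed.

(** * The auction as a structured program *)

(* Variables: 0 the answer; 2, 3, 4, 5 are n, m, l, tau; 6 is n * l and 7 the position
   of the constraints in the input; 8 the bidding timestep; 9 its number of allowed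
   slots; 10 and 12 the lowest price seen and where; 11 the number of disapprovals seen;
   the others are counters and temporaries.  Heap, from B - 78 on: B cells of input,
   B of prices, B of owners and then the flags of the matched timesteps.  Timestep k is
   stored as owner k + 1, so that owner 0 means unowned and flag 0 is a dummy.  The
   offset 78 = 2 * 40 - 2 comes from the relocation of the input by [prelude]. *)
Definition EBase : expr := ESub EBound (ECst 78).
Definition EIn (e : expr) : expr := EGet (EAdd EBase e).
Definition APrice (e : expr) : expr := EAdd EBase (EAdd EBound e).
Definition AOwner (e : expr) : expr := EAdd EBase (EAdd EBound (EAdd EBound e)).
Definition AAssigned (e : expr) : expr :=
  EAdd EBase (EAdd EBound (EAdd EBound (EAdd EBound e))).

Definition ScanSlot : cmd :=
  let pr := EGet (APrice (EAdd (EVar 14) (EVar 17))) in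
  If (ESub (EVar 10) pr)
     (Seq (Assign 10 pr) (Assign 12 (EAdd (EVar 14) (EVar 17)))) Skip.

Definition ScanProject : cmd :=
  If (EIn (EAdd (ECst 4) (EAdd (EVar 15) (EVar 16))))
     (Seq (Assign 11 (EAdd (EVar 11) (ECst 1))) (For 17 9 ScanSlot)) Skip.

Definition ScanAgent : cmd :=
  Seq (Mul 14 13 4 18)
 (Seq (Assign 19 (EAdd (EVar 14) (EVar 8)))
 (Seq (Mul 15 19 3 18)
      (For 16 3 ScanProject))).

Definition Scan : cmd :=
  Seq (Assign 10 (EAdd (EVar 4) (ECst 1)))
 (Seq (Assign 11 (ECst 0))
 (Seq (Assign 12 (ECst 0))
      (For 13 2 ScanAgent))).

(** Variable 9 becomes the minimum of [l] and the limits of all constraints that cover the bidding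
    timestep. A constraint takes two cells, hence the doubled counter in [cell]. *)
Definition Cap : cmd :=
  let cell := EAdd (EVar 7) (EAdd (EVar 1) (EVar 1)) in
  Seq (Assign 9 (EVar 4))
      (For 1 5
        (If (ESub (EIn cell) (EVar 8))
            (If (ESub (EVar 9) (EIn (EAdd cell (ECst 1))))
                (Assign 9 (EIn (EAdd cell (ECst 1)))) Skip) Skip)).

(** The order matters: the flag of the evicted owner is cleared while the owner cell still names
    it. *)
Definition Award : cmd :=
  Seq (Put (AAssigned (EGet (AOwner (EVar 12)))) (ECst 0))
 (Seq (Put (AOwner (EVar 12)) (EAdd (EVar 8) (ECst 1)))
 (Seq (Put (AAssigned (EAdd (EVar 8) (ECst 1))) (ECst 1))
      (Put (APrice (EVar 12)) (EAdd (EVar 10) (ECst 1))))).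

(** With at most one disapprover per project, some project is harmless exactly when there are fewer
    than [m] disapprovals. The value [l + 1] in variable 10 means that no allowed slot is cheaper,
    possibly because there is none. *)
Definition Settle : cmd :=
  If (ESub (EVar 3) (EVar 11))
     (Put (AAssigned (EAdd (EVar 8) (ECst 1))) (ECst 1))
 (If (ESub (EAdd (EVar 4) (ECst 1)) (EVar 10))
     Award
     (Assign 0 (ECst 0))).

Definition Bid : cmd := Seq Cap (Seq Scan Settle).

Definition Turn : cmd :=
  If (EVar 0)
     (If (EGet (AAssigned (EAdd (EVar 8) (ECst 1)))) Skip Bid) Skip.

Definition Sweep : cmd := For 8 4 Turn.

(** * Correctness of a single bid *)

Section Semantics.
Variables (B n m l tau : nat) (inp : nat -> nat).

Definition bit (i k p : nat) : bool := inp (4 + ((i * l + k) * m + p)) != 0.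

Definition slot_ok (k x : nat) : bool :=
  (x < l) && all (fun j => (k < inp (4 + n * l * m + (j + j))) ==>
                           (x < inp (4 + n * l * m + (j + j) + 1))) (iota 0 tau).

Definition disapprovals (k : nat) : nat := \sum_(i < n) \sum_(p < m) bit i k p.

Definition needy (k : nat) : Prop := m <= disapprovals k.

(** Slot [x] of agent [i] is the object [i * l + x]; a timestep may use it if some project there can
    be charged to [i]. *)
Definition edge (k r : nat) : Prop :=
  exists i p x, [/\ i < n, p < m, bit i k p, slot_ok k x & r = i * l + x].

(** Positivity of the sizes, together with [env_size], keeps every loop bound at most [B], as
    [For_ind] requires. *)
Record env (s : store) : Prop := Env {
  env_n : vars s 2 = n;
  env_m : vars s 3 = m;
  env_l : vars s 4 = l;
  env_tau : vars s 5 = tau;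
  env_c : vars s 7 = 4 + n * l * m;
  env_in : forall x, x < B -> heap s (B - 78 + x) = inp x;
  env_n0 : 0 < n;
  env_l0 : 0 < l;
  env_m0 : 0 < m;
  env_size : 4 + n * l * m + (tau + tau) <= B }.

Definition price_of (s : store) (r : nat) := heap s (B - 78 + (B + r)).
Definition owner_of (s : store) (r : nat) := heap s (B - 78 + (B + (B + r))).
Definition assigned_of (s : store) (k : nat) := heap s (B - 78 + (B + (B + (B + k)))).

Lemma env_frame s s' : env s ->
  (forall z, z \in [:: 2; 3; 4; 5; 7] -> vars s' z = vars s z) ->
  heap s' = heap s -> env s'.
Proof.
case=> h2 h3 h4 h5 h7 hi hn hl hm hs fr hp; split; rewrite ?fr //.
by move=> x xB; rewrite hp hi.
Qed.

Lemma env_run c s : env s -> pure c ->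
  all (fun z => z \notin writes c) [:: 2; 3; 4; 5; 7] -> env (run B c s).
Proof.
move=> e pc /allP wc; apply: env_frame e _ _; last exact: run_heap.
by move=> z /wc; exact: run_vars.
Qed.

Lemma bit_bound i k p : i < n -> k < l -> p < m ->
  4 + ((i * l + k) * m + p) < 4 + n * l * m.
Proof.
move=> hi hk hp; have : i * l + k < n * l.
  apply: leq_trans (_ : i.+1 * l <= _); first by rewrite mulSn addnC ltn_add2r.
  by rewrite leq_mul2r hi orbT.
move: (_ + k) (n * l) => a b ab.
have : a.+1 * m <= b * m by rewrite leq_mul2r ab orbT.
rewrite mulSn; lia.
Qed.

(** The slots allowed at a timestep form an initial segment, so one threshold describes them. *)
Lemma run_Cap s x : env s ->
  (x < vars (run B Cap s) 9) = slot_ok (vars s 8) x.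
Proof.
move=> es; rewrite /Cap.
set c := (X in For 1 5 X).
set s0 := run B (Assign 9 (EVar 4)) s.
have e0 : env s0 by apply: env_run.
have tB : vars s0 5 <= B by rewrite (env_tau e0); have := env_size e0; lia.
pose below j := (vars s 8 < inp (4 + n * l * m + (j + j))) ==>
                (x < inp (4 + n * l * m + (j + j) + 1)).
have belowS t : all below (iota 0 t.+1) = all below (iota 0 t) && below t.
  by rewrite -addn1 iotaD all_cat /= andbT.
suff : (x < vars (run B (For 1 5 c) s0) 9) = (x < l) && all below (iota 0 (vars s0 5)).
  by rewrite (env_tau e0).
apply: (For_ind (I := fun t s' => (x < vars s' 9) = (x < l) && all below (iota 0 t))) => //.
- by rewrite /= (env_l es) andbT.
- rewrite (env_tau e0) => j s' jt h1 fr hp IH.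
  have es' : env s'.
    apply: env_frame e0 _ (hp isT) => z hz; apply: fr.
    by move: hz; rewrite !inE => /or4P[/eqP->|/eqP->|/eqP->|/orP[]/eqP->].
  have h8 : vars s' 8 = vars s 8 by rewrite fr.
  rewrite belowS andbA -IH /= h1 h8 !(env_c es').
  have ib y : y <= 4 + n * l * m + (j + j) + 1 -> heap s' (B - 78 + y) = inp y.
    by move=> hy; apply: (env_in es'); have := env_size es'; lia.
  rewrite !ib; try lia.
  rewrite /below; set a := inp _; set b := inp _; rewrite subn_eq0.
  case: (leqP a (vars s 8)) => ha /=; first by rewrite andbT.
  by rewrite updE /=; case: (vars s' 9 - b =P 0) => hb; rewrite /= ?updE /=; lia.
Qed.

(** [P] stands for the objects inspected earlier; keeping it abstract lets the nested scans over
    slots, projects and agents compose. *)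
Lemma run_slots s c P : vars s 9 <= B ->
  cheapest c (price_of s) P (vars s 10) (vars s 12) ->
  let s' := run B (For 17 9 ScanSlot) s in
  cheapest c (price_of s)
    (fun r => P r \/ exists2 x, x < vars s 9 & r = vars s 14 + x)
    (vars s' 10) (vars s' 12).
Proof.
move=> cB ch; rewrite /=.
apply: (For_ind (c := ScanSlot) (I := fun j s' => cheapest c (price_of s)
    (fun r => P r \/ exists2 x, x < j & r = vars s 14 + x)
    (vars s' 10) (vars s' 12))) => //.
- by apply: cheapest_ext ch => r; split; [left | case=> // -[]].
- move=> j s' jc h17 fr hp IH.
  have h14 : vars s' 14 = vars s 14 by rewrite fr.
  have ext : forall r, (P r \/ (exists2 x, x < j & r = vars s 14 + x)) \/ r = vars s 14 + j
     <-> P r \/ (exists2 x, x < j.+1 & r = vars s 14 + x).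
    move=> r; split.
      by case=> [[|[x xj ->]]|->]; [left | right; exists x => //; lia | right; exists j].
    case=> [|[x xj ->]]; [by left; left |].
    move: xj; rewrite ltnS leq_eqVlt => /orP[/eqP->|xj]; first by right.
    by left; right; exists x.
  rewrite /= h17 h14 (hp isT).
  case: eqP => /= hb.
    apply: cheapest_ext ext _; apply: cheapest_keep IH _.
    by rewrite /price_of; lia.
  rewrite !updE /= ?updE /= ?h17 ?h14.
  apply: cheapest_ext ext _.
  by apply: (cheapest_switch (r1 := vars s 14 + j) IH); rewrite /price_of; lia.
Qed.

Lemma run_projects s c P i k : env s -> i < n -> k < l ->
  vars s 14 = i * l -> vars s 15 = (i * l + k) * m ->
  vars s 9 <= B -> (forall x, (x < vars s 9) = slot_ok k x) ->
  cheapest c (price_of s) P (vars s 10) (vars s 12) ->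
  let s' := run B (For 16 3 ScanProject) s in
  vars s' 11 = vars s 11 + \sum_(p < m) bit i k p /\
  cheapest c (price_of s)
    (fun r => P r \/ exists p x, [/\ p < m, bit i k p, slot_ok k x & r = i * l + x])
    (vars s' 10) (vars s' 12).
Proof.
move=> es iN kl h14 h15 cB capE ch s'.
have mB : vars s 3 <= B.
  rewrite (env_m es); have := env_size es.
  have := @leq_pmull m (n * l); rewrite muln_gt0; lia.
rewrite -(env_m es).
apply: (For_ind (c := ScanProject) (I := fun j s' =>
  vars s' 11 = vars s 11 + \sum_(p < j) bit i k p /\
  cheapest c (price_of s)
    (fun r => P r \/ exists p x, [/\ p < j, bit i k p, slot_ok k x & r = i * l + x])
    (vars s' 10) (vars s' 12))) => //.
- rewrite big_ord0 addn0; split=> //=.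
  by apply: cheapest_ext ch => r; split; [left | case=> // -[p [x []]]].
- rewrite (env_m es) => j {}s' jm h16 fr hp [IHc IHb].
  have -> : vars s 11 + \sum_(p < j.+1) bit i k p = vars s' 11 + bit i k j.
    by rewrite big_ord_recr /= addnA IHc.
  have es' : env s'.
    apply: env_frame es _ (hp isT) => z hz; apply: fr.
    by move: hz; rewrite !inE => /or4P[/eqP->|/eqP->|/eqP->|/orP[]/eqP->].
  have h15' : vars s' 15 = vars s 15 by rewrite fr.
  have h14' : vars s' 14 = vars s 14 by rewrite fr.
  have h9' : vars s' 9 = vars s 9 by rewrite fr.
  have inb : heap s' (B - 78 + (4 + (vars s' 15 + vars s' 16))) = inp (4 + ((i * l + k) * m + j)).
    rewrite h16 h15' h15 (env_in es') //.
    by have := bit_bound iN kl jm; have := env_size es; lia.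
  rewrite [run B ScanProject s']/= inb.
  have -> : (inp (4 + ((i * l + k) * m + j)) == 0) = ~~ bit i k j by rewrite negbK.
  case hb : (bit i k j) => /=.
    set s1 := Store (upd (vars s') 11 (vars s' 11 + 1)) (heap s').
    have := @run_slots s1 c (fun r => P r \/ exists p x, [/\ p < j, bit i k p, slot_ok k x & r = i * l + x]).
    rewrite -[iter B _ _]/(run B (For 17 9 ScanSlot) s1).
    have -> : vars s1 9 = vars s 9 by rewrite -h9'.
    have -> : vars s1 14 = i * l by rewrite -h14.
    have -> : price_of s1 = price_of s by rewrite /price_of /= (hp isT).
    move=> /(_ cB IHb) H; split.
      by rewrite upd_neq // run_vars.
    rewrite !upd_neq //; apply: cheapest_ext H => r; split.
      case=> [[|[p [x [pj bp sx ->]]]]|[x xc ->]]; first by left.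
        by right; exists p, x; split=> //; lia.
      by right; exists j, x; split=> //; rewrite -capE.
    case=> [|[p [x [pj bp sx ->]]]]; first by left; left.
    move: pj; rewrite ltnS leq_eqVlt => /orP[_|pj].
      by right; exists x; rewrite ?capE.
    by left; right; exists p, x.
  rewrite !updE /= addn0; split=> //; apply: cheapest_ext IHb => r; split.
    case=> [|[p [x [pj bp sx ->]]]]; first by left.
    by right; exists p, x; split=> //; lia.
  case=> [|[p [x [pj bp sx ->]]]]; first by left.
  move: pj; rewrite ltnS leq_eqVlt => /orP[/eqP e|pj]; first by rewrite e hb in bp.
  by right; exists p, x.
Qed.

Lemma nl_bound : 0 < m -> n * l <= n * l * m.
Proof. exact: leq_pmulr. Qed.

Lemma run_agent s c P i k : env s -> i < n -> k < l ->
  vars s 13 = i -> vars s 8 = k ->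
  vars s 9 <= B -> (forall x, (x < vars s 9) = slot_ok k x) ->
  cheapest c (price_of s) P (vars s 10) (vars s 12) ->
  let s' := run B ScanAgent s in
  vars s' 11 = vars s 11 + \sum_(p < m) bit i k p /\
  cheapest c (price_of s)
    (fun r => P r \/ exists p x, [/\ p < m, bit i k p, slot_ok k x & r = i * l + x])
    (vars s' 10) (vars s' 12).
Proof.
move=> es iN kl h13 h8 cB capE ch.
set c1 := Mul 14 13 4 18; set c2 := Assign 19 (EAdd (EVar 14) (EVar 8)).
set c3 := Mul 15 19 3 18.
have nB : n * l < B by have := env_size es; have := nl_bound (env_m0 es); lia.
have ilk : i * l + k < n * l.
  apply: leq_trans (_ : i.+1 * l <= _); first by rewrite mulSn addnC ltn_add2r.
  by rewrite leq_mul2r iN orbT.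
have iB : i <= B.
  apply: leq_trans (ltnW nB); apply: leq_trans (ltnW iN) _.
  exact: leq_pmulr (env_l0 es).
pose s1 := run B c1 s; pose s2 := run B c2 s1; pose s3 := run B c3 s2.
have h14 : vars s1 14 = i * l.
  by rewrite run_Mul ?(env_l es) ?h13.
have h19 : vars s2 19 = i * l + k.
  by rewrite /s2 /= updE /= h14 run_vars // h8.
have h15 : vars s3 15 = (i * l + k) * m.
  rewrite run_Mul ?h19 //; last by apply: ltnW; apply: ltn_trans ilk nB.
  by rewrite run_vars // run_vars // (env_m es).
have fr z : z \notin writes c1 -> z \notin writes c2 -> z \notin writes c3 ->
    vars s3 z = vars s z.
  by move=> z1 z2 z3; rewrite /s3 run_vars // /s2 run_vars // /s1 run_vars.
have hp : heap s3 = heap s by rewrite /s3 run_heap // /s2 run_heap // /s1 run_heap.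
have e3 : env s3 by do 3! apply: env_run => //.
move=> s'; have {s'}-> : s' = run B (For 16 3 ScanProject) s3 by [].
have pE : price_of s3 = price_of s by rewrite /price_of hp.
have := @run_projects s3 c P i k e3 iN kl.
have h14' : vars s3 14 = i * l by rewrite /s3 run_vars // /s2 run_vars.
rewrite pE h14' h15 !fr //.
by move=> /(_ erefl erefl cB capE ch).
Qed.

Lemma run_Scan s k : env s -> vars s 8 = k -> k < l ->
  (forall x, (x < vars s 9) = slot_ok k x) ->
  let s' := run B Scan s in
  vars s' 11 = disapprovals k /\
  cheapest l.+1 (price_of s) (edge k) (vars s' 10) (vars s' 12).
Proof.
move=> es h8 kl capE.
have nlB : n * l < B by have := env_size es; have := nl_bound (env_m0 es); lia.
have nB : n <= B.
  by apply: leq_trans (ltnW nlB); exact: leq_pmulr (env_l0 es).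
pose s1 := run B (Seq (Assign 10 (EAdd (EVar 4) (ECst 1))) (Seq (Assign 11 (ECst 0)) (Assign 12 (ECst 0)))) s.
have e1 : env s1 by apply: env_run.
move=> s'; have {s'}-> : s' = run B (For 13 2 ScanAgent) s1 by [].
set s' := run B _ s1; rewrite /disapprovals.
have ext r : (exists i p x, [/\ i < vars s1 2, p < m, bit i k p, slot_ok k x & r = i * l + x])
    <-> edge k r by rewrite (env_n e1).
suff [H1 H2] : vars s' 11 = \sum_(i < vars s1 2) \sum_(p < m) bit i k p /\
   cheapest l.+1 (price_of s)
     (fun r => exists i p x, [/\ i < vars s1 2, p < m, bit i k p, slot_ok k x & r = i * l + x])
     (vars s' 10) (vars s' 12).
  by split; [rewrite H1 (env_n e1) | exact: cheapest_ext ext H2].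
apply: (For_ind (I := fun j s' => vars s' 11 = \sum_(i < j) \sum_(p < m) bit i k p /\
   cheapest l.+1 (price_of s)
     (fun r => exists i p x, [/\ i < j, p < m, bit i k p, slot_ok k x & r = i * l + x])
     (vars s' 10) (vars s' 12))) => //.
- by rewrite (env_n e1).
(* No object has been seen yet, so the minimum is the cap [l.+1] and the witness condition is
   void. *)
- rewrite big_ord0; split=> //=; split; rewrite /= ?updE /= ?(env_l es) ?addn1 //.
    by move=> r [i [p [x []]]].
  by rewrite ltnn.
- rewrite (env_n e1) => j {}s' jn h13 fr hp [IHc IHb].
  have hp' : heap s' = heap s by rewrite hp.
  have e' : env s'.
    apply: env_frame e1 _ (hp isT) => z hz; apply: fr.
    by move: hz; rewrite !inE => /or4P[/eqP->|/eqP->|/eqP->|/orP[]/eqP->].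
  have h8' : vars s' 8 = k by rewrite fr.
  have h9' : vars s' 9 = vars s 9 by rewrite fr.
  have cl : vars s 9 <= l.
    by rewrite leqNgt; apply/negP; rewrite capE /slot_ok ltnn.
  have cB : vars s 9 <= B.
    apply: leq_trans cl _; apply: leq_trans (ltnW nlB).
    by apply: leq_pmull; apply: leq_ltn_trans jn.
  have pE : price_of s' = price_of s by rewrite /price_of hp'.
  have := @run_agent s' l.+1 _ j k e' jn kl h13 h8'.
  rewrite h9' pE => /(_ _ cB capE IHb)[H1 H2].
  rewrite ![vars (setv _ _ _) _]upd_neq //.
  split; first by rewrite H1 IHc big_ord_recr.
  apply: cheapest_ext H2 => r; split.
    case=> [[i [p [x [ij pm bp sx ->]]]]|[p [x [pm bp sx ->]]]].
      by exists i, p, x; split=> //; apply: ltnW.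
    by exists j, p, x.
  case=> [i [p [x [ij pm bp sx ->]]]].
  move: ij bp; rewrite ltnS leq_eqVlt => /orP[/eqP->|ij] bp.
    by right; exists p, x.
  by left; exists i, p, x.
Qed.


(** The cases supply the hypotheses of [auction_free], [auction_bid] and [stuck_not_matchable].
    Equations are limited to valid indices because the arrays are adjacent in the heap. *)
Inductive bid_spec (s : store) (k : nat) (s' : store) : Prop :=
  | BidFree of ~ needy k & vars s' 0 = vars s 0 &
      (forall r, r < n * l -> price_of s' r = price_of s r) &
      (forall r, r < n * l -> owner_of s' r = owner_of s r) &
      (forall j, j <= l -> assigned_of s' j = if j == k.+1 then 1 else assigned_of s j)
  | BidAward b r0 of needy k & vars s' 0 = vars s 0 &
      cheapest l.+1 (price_of s) (edge k) b r0 & b < l.+1 &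
      (forall r, r < n * l -> price_of s' r = if r == r0 then b.+1 else price_of s r) &
      (forall r, r < n * l -> owner_of s' r = if r == r0 then k.+1 else owner_of s r) &
      (forall j, j <= l -> assigned_of s' j = if j == k.+1 then 1 else
                             if j == owner_of s r0 then 0 else assigned_of s j)
  | BidFail of needy k & vars s' 0 = 0 & (forall r, edge k r -> l < price_of s r).

Lemma edge_lt k r : edge k r -> r < n * l.
Proof.
case=> i [p [x [iN _ _ /andP[xl _] ->]]].
apply: leq_trans (_ : i.+1 * l <= _); first by rewrite mulSn addnC ltn_add2r.
by rewrite leq_mul2r iN orbT.
Qed.

Lemma run_Settle s k : env s -> vars s 8 = k -> k < l -> vars s 11 = disapprovals k ->
  cheapest l.+1 (price_of s) (edge k) (vars s 10) (vars s 12) ->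
  let s' := run B Settle s in env s' /\ bid_spec s k s'.
Proof.
move=> es h8 kl hc hb.
have nlB : n * l < B by have := env_size es; have := nl_bound (env_m0 es); lia.
have lB : l < B by apply: leq_ltn_trans nlB; exact: leq_pmull (env_n0 es).
(* The input occupies the [B] cells from [B - 78] on, below every cell that [Settle] writes. *)
have env_put s' : (forall a, a < B - 78 + B -> heap s' a = heap s a) ->
    vars s' = vars s -> env s'.
  case: es => v2 v3 v4 v5 v7 hi n0 l0 m0 sz hp vp; split; rewrite ?vp //.
  by move=> x xB; rewrite hp ?ltn_add2l ?hi.
have mE : vars s 3 = m by exact: env_m.
have lE : vars s 4 = l by exact: env_l.
rewrite /Settle /= mE hc lE addn1.
case: (m - disapprovals k =P 0) => hm; last first.
  split.
    by apply: env_put => //= a aB; rewrite upd_neq // h8; lia.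
  apply: BidFree => //=.
  - by rewrite /needy; lia.
  - by move=> r rn; rewrite /price_of /= upd_neq // h8; lia.
  - by move=> r rn; rewrite /owner_of /= upd_neq // h8; lia.
  - move=> j jl; rewrite /assigned_of /= updE h8 !eqn_add2l addn1; by [].
have nk : needy k by rewrite /needy; lia.
have [hb1 hb2 hb3] := hb.
case: (l.+1 - vars s 10 =P 0) => hl; last first.
  have bl : vars s 10 < l.+1 by lia.
  have [er pr] := hb3 bl.
  have r0n := edge_lt er.
  rewrite h8 !addn1.
  split.
    by apply: env_put => //= a aB; rewrite !upd_neq //; lia.
  apply: (BidAward (b := vars s 10) (r0 := vars s 12)) => //=.
  - move=> r rn; rewrite /price_of /= updE !eqn_add2l; case: eqP => // _.
    by rewrite !upd_neq //; lia.
  - move=> r rn; rewrite /owner_of /= upd_neq; last lia.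
    rewrite upd_neq; last lia.
    rewrite updE !eqn_add2l; case: eqP => // _.
    by rewrite !upd_neq //; lia.
  - move=> j jl; rewrite /assigned_of /= upd_neq; last lia.
    rewrite updE !eqn_add2l; case: eqP => // _.
    rewrite upd_neq; last lia.
    by rewrite updE !eqn_add2l.
split; first by apply: env_frame es _ _ => // z; rewrite !inE => /or4P[/eqP->|/eqP->|/eqP->|/orP[]/eqP->].
by apply: BidFail => // r er; have := hb2 _ er; lia.
Qed.

Lemma bid_spec_ext s s2 k s' : heap s2 = heap s -> vars s2 0 = vars s 0 ->
  bid_spec s2 k s' -> bid_spec s k s'.
Proof.
move=> hp h0; have pE : price_of s2 = price_of s by rewrite /price_of hp.
have oE : owner_of s2 = owner_of s by rewrite /owner_of hp.
have aE : assigned_of s2 = assigned_of s by rewrite /assigned_of hp.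
case; rewrite ?pE ?oE ?aE ?h0.
- by move=> *; apply: BidFree.
- by move=> b r0 *; apply: (@BidAward _ _ _ b r0).
- by move=> *; apply: BidFail.
Qed.

Lemma run_Bid s k : env s -> vars s 8 = k -> k < l ->
  let s' := run B Bid s in env s' /\ bid_spec s k s'.
Proof.
move=> es h8 kl s'.
pose s1 := run B Cap s; pose s2 := run B Scan s1.
have e1 : env s1 by apply: env_run.
have e2 : env s2 by apply: env_run.
have hp1 : heap s1 = heap s by rewrite /s1 run_heap.
have hp2 : heap s2 = heap s by rewrite /s2 run_heap.
have h81 : vars s1 8 = k by rewrite /s1 run_vars.
have h82 : vars s2 8 = k by rewrite /s2 run_vars.
have h02 : vars s2 0 = vars s 0 by rewrite /s2 run_vars // /s1 run_vars.
have capE x : (x < vars s1 9) = slot_ok k x by rewrite run_Cap // h8.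
have [hc hb] := run_Scan e1 h81 kl capE.
have pE : price_of s1 = price_of s2 by rewrite /price_of hp1 hp2.
rewrite pE in hb.
have {s'}-> : s' = run B Settle s2 by [].
have [e3 sp] := run_Settle e2 h82 kl hc hb.
by split=> //; apply: bid_spec_ext sp.
Qed.

End Semantics.

(** * Sweeps and termination of the auction *)

Section Loops.
Variables (B n m l tau : nat) (inp : nat -> nat).
Notation env := (env B n m l tau inp).
Notation needy := (needy n m l inp).
Notation edge := (edge n m l tau inp).
Notation price_of := (price_of B).
Notation owner_of := (owner_of B).
Notation assigned_of := (assigned_of B).

Definition refuted (s : store) : Prop := vars s 0 = 0 /\ ~ matchable l needy edge.

Definition live (s : store) : Prop :=
  vars s 0 = 1 /\
  auction_inv l (n * l) needy edge (price_of s) (owner_of s) (assigned_of s).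

(** The potential of the auction: each award raises it by one, and [price_le] bounds it. *)
Definition total (s : store) : nat := \sum_(r < n * l) price_of s r.

Definition all_assigned (s : store) : Prop :=
  forall k, k < l -> assigned_of s k.+1 != 0.

Lemma env_setv s x v : x \notin [:: 2; 3; 4; 5; 7] -> env s -> env (setv s x v).
Proof.
move=> hx e; apply: env_frame e _ _ => // z hz.
by rewrite [vars _ _]upd_neq //; apply: contraNneq hx => <-.
Qed.

Lemma run_Turn s k : env s -> vars s 8 = k -> k < l -> live s ->
  let s' := run B Turn s in
  env s' /\ (refuted s' \/ live s' /\
    ((assigned_of s k.+1 = 0 /\ total s' = (total s).+1) \/
     [/\ total s' = total s, assigned_of s' k.+1 != 0 &
         forall j, j <= l -> assigned_of s j != 0 -> assigned_of s' j != 0])).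
Proof.
move=> es h8 kl lv; have [h0 inv] := lv.
have -> : run B Turn s = if assigned_of s k.+1 == 0 then run B Bid s else s.
  by rewrite /Turn run_If [eval _ _ _]/= h0 run_If [eval _ _ _]/= h8 addn1.
case: eqP => [ak|/eqP ak] s'; last by split=> //; right; split=> //; right.
have := run_Bid es h8 kl; rewrite -/s' => -[e' [nk v0 pE oE aE|b r0 nk v0 ch bl pE oE aE|nk v0 dear]].
all: split=> //; clearbody s'.
- right; split.
    split; first by rewrite v0.
    have [i1 i2 i3 i4 i5 i6] := auction_free inv nk aE.
    split.
    + by move=> r rN; rewrite oE //; exact: i1.
    + by move=> r r' rN; rewrite oE // pE // => o0 r'N; rewrite pE //; exact: i2.
    + by move=> r r' rN r'N; rewrite !oE //; exact: i3.
    + by move=> k' k'L k'n as'; have [r rN e] := i4 k' k'L k'n as'; exists r; rewrite ?oE.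
    + by move=> r rN; rewrite oE // pE //; exact: i5.
    + by move=> r rN; rewrite pE //; exact: i6.
  right; split.
  + by apply: eq_bigr => r _; rewrite pE.
  + by rewrite aE // eqxx.
  + by move=> j jl aj; rewrite aE //; case: (j =P k.+1).
- right; split.
    split; first by rewrite v0.
    exact: auction_bid (fun k r _ => @edge_lt n m l tau inp k r) inv kl nk ak ch bl pE oE aE.
  left; split=> //.
  have [_ _ /(_ bl)[er0 pr0]] := ch.
  have r0N := edge_lt er0.
  rewrite /total (bigD1 (Ordinal r0N)) //= [in RHS](bigD1 (Ordinal r0N)) //=.
  rewrite pE // eqxx pr0 -addSn; congr (_ + _).
  by apply: eq_bigr => r nr; rewrite pE // ifF //; apply: negbTE; apply: contraNneq nr => e; apply/eqP/val_inj.
- left; split=> //.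
  exact: (stuck_not_matchable (fun k r _ => @edge_lt n m l tau inp k r) inv kl nk ak dear).
Qed.

(** A sweep that neither refutes nor raises a price awards nothing, so every timestep is flagged
    after its turn and no flag is lost. *)
Lemma run_Sweep s : env s -> refuted s \/ live s ->
  let s' := run B Sweep s in
  env s' /\ (refuted s' \/ [/\ live s', all_assigned s -> all_assigned s' &
     live s /\ (total s < total s' \/ all_assigned s')]).
Proof.
move=> es st s'.
have lB : vars s 4 <= B.
  rewrite (env_l es); have := env_size es; have := nl_bound n l (env_m0 es).
  have := leq_pmull l (env_n0 es); lia.
pose J j s' := env s' /\ (refuted s' \/ live s /\ [/\ live s', all_assigned s -> all_assigned s',
   total s <= total s' & total s < total s' \/ forall k, k < j -> assigned_of s' k.+1 != 0]).
suff [e' J'] : J (vars s 4) s'.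
  split=> //; case: J' => [|[ls [ls' aa _ tt]]]; [by left | right; split=> //].
  by split=> //; case: tt => [|h]; [left | right; move=> k kl; apply: h; rewrite (env_l es)].
apply: For_ind => //.
  split; first exact: env_setv.
  by case: st => [|ls]; [left | right; split=> //; split=> //; right].
rewrite (env_l es) => j {}s' jl h8 fr _ [e' st'].
case: st' => [rf|[ls [ls' aa tle tt]]].
  have -> : run B Turn s' = s' by case: rf => h0 _; rewrite /Turn run_If [eval _ _ _]/= h0.
  by split; [exact: env_setv | left].
have := run_Turn e' h8 jl ls'; move: (run B Turn s') => u [e'' rs].
split; first exact: env_setv.
case: rs => [|[ls'' rs]]; first by left.
right; split=> //; split=> //; move: rs.
- case=> [[aj _] /aa /(_ j jl)|[_ _ mono] /aa al k kl]; first by rewrite aj.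
  by apply: mono => //; exact: al.
- by rewrite /total /=; case=> [[_ ->]|[-> _ _]] //; apply: leqW.
- case=> [[_ tS]|[tE aj mono]].
    by left; move: tS; rewrite /total /= => ->.
  case: tt => [tt|tt]; [left | right].
    by move: tE; rewrite /total /= => ->.
  move=> k; rewrite ltnS leq_eqVlt => /orP[/eqP->//|kj].
  by apply: mono (tt k kj); apply: leq_trans kj _; apply: ltnW.
Qed.

(** Until a refutation or a complete assignment, each of the [B * B] sweeps raises the total
    price. *)
Lemma run_auction s : env s -> live s ->
  let s' := run B (Rep (Rep Sweep)) s in
  (vars s' 0 = 0 /\ ~ matchable l needy edge) \/
  (vars s' 0 = 1 /\ matchable l needy edge).
Proof.
move=> es ls s'.
have {s'}-> : s' = iter (B * B) (run B Sweep) s by rewrite iterM.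
have main t : let u := iter t (run B Sweep) s in
    env u /\ (refuted u \/ live u /\ (all_assigned u \/ t <= total u)).
  elim: t => [|t]; first by split=> //; right; split=> //; right.
  rewrite iterS; move: (iter t _ s) => u [e st].
  have st' : refuted u \/ live u by case: st => [|[]]; [left | right].
  have [e1 r1] := run_Sweep e st'.
  split=> //; case: r1 => [|[lv' aa [lu tt]]]; first by left.
  right; split=> //; case: tt => [tt|]; last by left.
  case: st => [[h0 _]|[_ [al|tot]]]; [by case: lu; rewrite h0|by left; apply: aa|right].
  exact: leq_ltn_trans tot tt.
have [e'] := main (B * B); move: (iter (B * B) _ s) e' => u e' st.
case: st => [|[[h0 inv] st]]; [by left | right; split=> //].
case: st => [al|tot]; first exact: assigned_matchable inv al.
have nlB : n * l < B.
  by have := env_size es; have := nl_bound n l (env_m0 es); lia.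
have lB : l < B by apply: leq_ltn_trans nlB; exact: leq_pmull (env_n0 es).
(* Since [n * l < B] and [l < B], the bound is below [B * B], so the total cannot have risen in
   every sweep. *)
suff : total u <= n * l * l.+1 by nia.
have -> : n * l * l.+1 = \sum_(r < n * l) l.+1 by rewrite sum_nat_const card_ord.
by apply: leq_sum => r _; apply: (price_le inv).
Qed.

End Loops.

(* [prelude] has moved the first 39 input entries to the heap cells from B - 78 on; the
   others, still at heap cells 0, 1, ..., have to follow them. *)
Definition CopyInput : cmd :=
  Seq (Assign 6 EBase)
      (For 1 6 (Put (EAdd EBase (EAdd (ECst 39) (EVar 1))) (EGet (EVar 1)))).

Definition Setup : cmd :=
  Seq (Assign 2 (EIn (ECst 0)))
 (Seq (Assign 3 (EIn (ECst 1)))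
 (Seq (Assign 4 (EIn (ECst 2)))
 (Seq (Assign 5 (EIn (ECst 3)))
 (Seq (Mul 6 2 4 18)
 (Seq (Mul 7 6 3 18)
 (Seq (Assign 7 (EAdd (ECst 4) (EVar 7)))
      (Assign 0 (ECst 1)))))))).

Definition Main : cmd := Seq CopyInput (Seq Setup (Rep (Rep Sweep))).

(** The state left by [prelude]: the first saved address [B - 38] is heap cell [B - 78], and heap
    cell [j] is register [40 + j], where input entry [39 + j] starts out. *)
Record loaded (B : nat) (inp : nat -> nat) (s : store) : Prop := Loaded {
  loaded_low : forall x, x < 39 -> heap s (B - 78 + x) = inp x;
  loaded_mid : forall j, j < B - 78 -> heap s j = inp (39 + j);
  loaded_high : forall a, B - 78 + 39 <= a -> heap s a = 0 }.

Lemma run_CopyInput B inp s : loaded B inp s ->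
  (forall x, B - 78 + 39 <= x -> inp x = 0) ->
  forall x, heap (run B CopyInput s) (B - 78 + x) = inp x.
Proof.
move=> [lo mid hi] big.
pose s0 := run B (Assign 6 EBase) s.
pose K := B - 78.
(* Sources lie below [K] and targets from [K + 39] on, so no entry is overwritten before it is
   copied. *)
suff H a : heap (run B CopyInput s) a = if K + 39 <= a < K + 39 + K then inp (a - K) else heap s a.
  move=> x; rewrite H -/K; case: ifP => h; first by congr inp; lia.
  have [x39|x39] := ltnP x 39; first exact: lo.
  by rewrite hi ?big //; lia.
have v6 : vars s0 6 = K by [].
have -> : run B CopyInput s = run B (For 1 6 (Put (EAdd EBase (EAdd (ECst 39) (EVar 1))) (EGet (EVar 1)))) s0 by [].
rewrite -{2}v6; move: a.
apply: (For_ind (I := fun j s' => forall a, heap s' a = if K + 39 <= a < K + 39 + j then inp (a - K) else heap s a)) => //.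
- by rewrite v6 leq_subr.
- by move=> a; rewrite ifF //; lia.
- rewrite v6 => j s' jK h1 _ _ IH a.
  rewrite /= updE h1 !IH -/K.
  have [-> {a}|na] := eqVneq a (K + (39 + j)).
    rewrite ifF; last lia.
    rewrite ifT; last lia.
    by rewrite mid //; congr inp; lia.
  by congr (if _ then _ else _); lia.
Qed.

Lemma run_Main B n m l tau inp s : loaded B inp s ->
  0 < n -> 0 < m -> 0 < l -> 4 + n * l * m + (tau + tau) <= B - 78 ->
  [/\ inp 0 = n, inp 1 = m, inp 2 = l & inp 3 = tau] ->
  (forall x, 4 + n * l * m + (tau + tau) <= x -> inp x = 0) ->
  let s' := run B Main s in
  let P := matchable l (needy n m l inp) (edge n m l tau inp) in
  (vars s' 0 = 0 /\ ~ P) \/ (vars s' 0 = 1 /\ P).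
Proof.
move=> ld n0 m0 l0 sz [i0 i1 i2 i3] big s' P.
pose s1 := run B CopyInput s; pose s2 := run B Setup s1.
have h1 x : heap s1 (B - 78 + x) = inp x.
  by apply: run_CopyInput ld _ x => x hx; apply: big; lia.
have hp2 : heap s2 = heap s1 by rewrite run_heap.
pose t1 := run B (Seq (Assign 2 (EIn (ECst 0)))
 (Seq (Assign 3 (EIn (ECst 1)))
 (Seq (Assign 4 (EIn (ECst 2))) (Assign 5 (EIn (ECst 3)))))) s1.
pose t2 := run B (Mul 6 2 4 18) t1; pose t3 := run B (Mul 7 6 3 18) t2.
have sE : s2 = run B (Seq (Assign 7 (EAdd (ECst 4) (EVar 7))) (Assign 0 (ECst 1))) t3 by [].
have nlB : n * l <= B by have := nl_bound n l m0; lia.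
have a2 : vars t1 2 = n by rewrite /= !updE /= h1.
have a3 : vars t1 3 = m by rewrite /= !updE /= h1.
have a4 : vars t1 4 = l by rewrite /= !updE /= h1.
have a5 : vars t1 5 = tau by rewrite /= !updE /= h1.
have b6 : vars t2 6 = n * l.
  by rewrite run_Mul // ?a2 ?a4 //; apply: leq_trans nlB; exact: leq_pmulr.
have b3 : vars t2 3 = m by rewrite /t2 run_vars.
have c7 : vars t3 7 = n * l * m by rewrite run_Mul ?b6 ?b3.
have cE z : z \in [:: 2; 3; 4; 5] -> vars s2 z = vars t1 z.
  by rewrite !inE => /or4P[]/eqP->; rewrite sE run_vars // /t3 run_vars // /t2 run_vars.
have e2 : env B n m l tau inp s2.
  split=> //.
  - by rewrite cE.
  - by rewrite cE.
  - by rewrite cE.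
  - by rewrite cE.
  - by rewrite sE /= upd_neq // updE /= c7.
  - by move=> x _; rewrite hp2 h1.
  - by apply: leq_trans sz _; exact: leq_subr.
(* Prices, owners and flags lie beyond the input and are still 0, the starting state of the
   auction. *)
have cell x : B <= x -> heap s2 (B - 78 + x) = 0.
  by move=> xB; rewrite hp2 h1 big //; lia.
have l2 : live B n m l tau inp s2.
  split; first by rewrite sE.
  by apply: auction_init => x _; apply: cell; lia.
have -> : s' = run B (Rep (Rep Sweep)) s2 by [].
exact: run_auction e2 l2.
Qed.

(** * Outcomes and matchings *)

Lemma size_flatten_uniform (T : Type) (w : nat) (ss : seq (seq T)) :
  all (fun s => size s == w) ss -> size (flatten ss) = size ss * w.
Proof. by elim: ss => //= s ss IH /andP[/eqP sw /IH e]; rewrite size_cat sw e mulSn. Qed.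

Lemma nth_flatten_uniform (T : Type) (x0 : T) (w : nat) (ss : seq (seq T)) i j :
  all (fun s => size s == w) ss -> i < size ss -> j < w ->
  nth x0 (flatten ss) (i * w + j) = nth x0 (nth [::] ss i) j.
Proof.
elim: ss i => // s ss IH [|i] /= /andP[/eqP sw al] hi hj; rewrite nth_cat sw.
  by rewrite hj.
by rewrite mulSn ifF ?IH //; [rewrite -addnA addKn IH | lia].
Qed.

Lemma nth_map_enum (T : Type) (x0 : T) n (f : 'I_n -> T) (i : 'I_n) :
  nth x0 [seq f j | j <- enum 'I_n] i = f i.
Proof. by rewrite (nth_map i) ?size_enum_ord // nth_ord_enum. Qed.

(** * Layout of the encoded instance *)

Section Encoding.
Variables (n m l : nat) (D : 'I_n -> 'I_l -> {set 'I_m}) (A : seq (nat * nat)).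

Let bits := flatten [seq flatten [seq [seq nat_of_bool (p \in D i k) | p <- enum 'I_m]
                          | k <- enum 'I_l] | i <- enum 'I_n].
Let cons := flatten [seq [:: c.1; c.2] | c <- A].

Let row_size i : all (fun s => size s == m)
  [seq [seq nat_of_bool (p \in D i k) | p <- enum 'I_m] | k <- enum 'I_l].
Proof. by apply/allP=> s /mapP[k _ ->]; rewrite size_map size_enum_ord. Qed.

Let block_size : all (fun s => size s == l * m)
  [seq flatten [seq [seq nat_of_bool (p \in D i k) | p <- enum 'I_m]
                          | k <- enum 'I_l] | i <- enum 'I_n].
Proof.
apply/allP=> s /mapP[i _ ->].
by rewrite (size_flatten_uniform (row_size i)) size_map size_enum_ord.
Qed.

Let size_bits : size bits = n * l * m.
Proof. by rewrite (size_flatten_uniform block_size) size_map size_enum_ord mulnA. Qed.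

Let pair_size : all (fun s => size s == 2) [seq [:: c.1; c.2] | c <- A].
Proof. by apply/allP=> s /mapP[c _ ->]. Qed.

Lemma size_encode : size (encode D A) = 4 + n * l * m + (size A + size A).
Proof.
rewrite /encode size_cat size_cat -/bits size_bits -/cons.
by rewrite (size_flatten_uniform pair_size) size_map muln2 addnn addnA.
Qed.

Lemma encode_bit (i : 'I_n) (k : 'I_l) (p : 'I_m) :
  nth 0 (encode D A) (4 + ((i * l + k) * m + p)) = (p \in D i k).
Proof.
rewrite [nth _ _ _]/= nth_cat -/bits size_bits ifT; last first.
  have := bit_bound (ltn_ord i) (ltn_ord k) (ltn_ord p); lia.
have -> : (i * l + k) * m + p = i * (l * m) + (k * m + p) by rewrite mulnDl mulnA addnA.
have kp : k * m + p < l * m.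
  apply: leq_trans (_ : k.+1 * m <= _); first by rewrite mulSn addnC ltn_add2r.
  by rewrite leq_mul2r ltn_ord orbT.
rewrite (nth_flatten_uniform _ block_size) //; last by rewrite size_map size_enum_ord.
rewrite nth_map_enum (nth_flatten_uniform _ (row_size i)) //; last by rewrite size_map size_enum_ord.
by rewrite !nth_map_enum.
Qed.

Let encode_pair j b : j < size A -> b < 2 ->
  nth 0 (encode D A) (4 + n * l * m + (j + j) + b) =
  nth 0 [:: (nth (0, 0) A j).1; (nth (0, 0) A j).2] b.
Proof.
move=> jA b2; rewrite -!addnA [nth _ _ _]/= nth_cat -/bits size_bits ifF; last lia.
rewrite add0n addKn -/cons addnA addnn -muln2 (nth_flatten_uniform _ pair_size) ?size_map //.
by rewrite (nth_map (0, 0)).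
Qed.

Lemma encode_time j : j < size A ->
  nth 0 (encode D A) (4 + n * l * m + (j + j)) = (nth (0, 0) A j).1.
Proof. by move=> jA; rewrite -[_ + (j + j)]addn0 encode_pair. Qed.

Lemma encode_limit j : j < size A ->
  nth 0 (encode D A) (4 + n * l * m + (j + j) + 1) = (nth (0, 0) A j).2.
Proof. by move=> jA; rewrite encode_pair. Qed.

Let inp := nth 0 (encode D A).

Lemma slot_okP k x : reflect (x < l /\ forall c, c \in A -> k < c.1 -> x < c.2)
  (slot_ok n m l (size A) inp k x).
Proof.
apply: (iffP andP) => -[xl h]; split=> //.
  move=> c /(nthP (0, 0))[j jA <-] kc.
  have /(allP h) : j \in iota 0 (size A) by rewrite mem_iota.
  by rewrite /inp encode_time // encode_limit // kc.
apply/allP=> j; rewrite mem_iota /= => jA; apply/implyP.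
by rewrite /inp encode_time // encode_limit // => /h; apply; exact: mem_nth.
Qed.

Lemma bitE (i : 'I_n) (k : 'I_l) (p : 'I_m) : bit m l inp i k p = (p \in D i k).
Proof. by rewrite /bit /inp encode_bit; case: (p \in D i k). Qed.

(** * Equivalence of feasible outcomes and matchings *)

Hypothesis gamma1 : gamma D <= 1.

Lemma disapprover_unique (i i' : 'I_n) (k : 'I_l) (p : 'I_m) :
  p \in D i k -> p \in D i' k -> i = i'.
Proof.
move=> pi pi'; have : #|[set i : 'I_n | p \in D i k]| <= 1.
  apply: leq_trans gamma1; rewrite /gamma.
  apply: leq_trans (leq_bigmax k); exact: (leq_bigmax p).
by move/card_le1_eqP; apply; rewrite inE.
Qed.

(** After the exchange of sums each project contributes at most 1, so a total of [m] forces all of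
    them to contribute. *)
Lemma needyP (k : 'I_l) :
  reflect (forall p : 'I_m, exists i : 'I_n, p \in D i k) (m <= disapprovals n m l inp k).
Proof.
have -> : disapprovals n m l inp k = \sum_(p < m) \sum_(i < n) (p \in D i k).
  rewrite /disapprovals exchange_big /=.
  by apply: eq_bigr => p _; apply: eq_bigr => i _; rewrite bitE.
have one (p : 'I_m) (i : 'I_n) : p \in D i k -> \sum_(i < n) (p \in D i k) = 1.
  move=> pi; rewrite (bigD1 i) //= pi big1 // => i' ni.
  by case pi' : (p \in D i' k) => //; rewrite (disapprover_unique pi pi') eqxx in ni.
apply: (iffP idP) => [le p|h]; last first.
  rewrite -{1}(card_ord m) -sum1_card; apply: leq_sum => p _.
  by have [i pi] := h p; rewrite (one p i).
case: (pickP (fun i : 'I_n => p \in D i k)) => [i pi|none]; first by exists i.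
move: le; rewrite (bigD1 p) //= big1; last by move=> i _; rewrite none.
have : \sum_(p' < m | p' != p) \sum_(i < n) (p' \in D i k) <= \sum_(p' < m | p' != p) 1.
  apply: leq_sum => p' _.
  case: (pickP (fun i : 'I_n => p' \in D i k)) => [i pi|none']; first by rewrite (one p' i).
  by rewrite big1 // => i _; rewrite none'.
rewrite sum1_card cardC1 card_ord; have := ltn_ord p => pm h1 h2; exfalso; have := leq_trans h2 h1; lia.
Qed.

Lemma disutil_mono i o t t' : t <= t' -> disutil D i o t <= disutil D i o t'.
Proof.
move=> tt; apply/subset_leq_card/subsetP=> k; rewrite !inE => /andP[kt ->].
by rewrite (leq_trans kt tt).
Qed.

Lemma disutil_step i o (k : 'I_l) : o k \in D i k -> disutil D i o k < disutil D i o k.+1.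
Proof.
move=> ok; apply/proper_card/properP; split.
  by apply/subsetP=> j; rewrite !inE => /andP[jk ->]; rewrite ltnS ltnW.
by exists k; rewrite !inE ?ok ?ltnSn ?ltnn.
Qed.

(** Timestep [k] takes the slot numbered by the disutility of the charged agent before [k]. It grows
    strictly with each charge, hence injectivity; with the charge at [k] included it is still at
    most [c.2] whenever [k < c.1]. *)
Lemma feasible_matchable : min_max_feasible D A ->
  matchable l (needy n m l inp) (edge n m l (size A) inp).
Proof.
case=> o ho.
have dle c i : c \in A -> disutil D i o c.1 <= c.2.
  by move=> cA; apply: leq_trans (ho c cA); exact: (leq_bigmax i).
have slot i (k : 'I_l) : o k \in D i k -> slot_ok n m l (size A) inp k (disutil D i o k).
  move=> ok; apply/slot_okP; split.
    by apply: leq_trans (disutil_step ok) _; rewrite -[X in _ <= X](card_ord l) max_card.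
  move=> c cA kc; apply: leq_trans (disutil_step ok) _.
  exact: leq_trans (disutil_mono i o kc) (dle c i cA).
pose f k := if insub k is Some kk then
   if [pick i : 'I_n | o kk \in D i kk] is Some i then i * l + disutil D i o k else 0 else 0.
have fE k : k < l -> needy n m l inp k ->
    exists (i : 'I_n) (kk : 'I_l), [/\ val kk = k, o kk \in D i kk & f k = i * l + disutil D i o k].
  move=> kl nk; rewrite /f insubT; set kk := Sub k kl.
  have /needyP /(_ (o kk))[i oi] : m <= disapprovals n m l inp kk by [].
  case: pickP => [i' oi'|/(_ i)]; last by rewrite oi.
  by exists i', kk.
exists f; split=> [k kl nk|k k' kl k'l nk nk'].
  have [i [kk [ek ok ->]]] := fE k kl nk.
  exists (nat_of_ord i), (nat_of_ord (o kk)), (disutil D i o k).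
  by split=> //; rewrite -ek ?bitE //; exact: slot.
have [i [kk [ek ok ->]]] := fE k kl nk; have [i' [kk' [ek' ok' ->]]] := fE k' k'l nk'.
have /slot_okP[xl _] := slot _ _ ok; have /slot_okP[xl' _] := slot _ _ ok'.
move: xl xl'; rewrite -ek -ek' in kl k'l *; move=> xl xl' e.
have l0 : 0 < l by apply: leq_ltn_trans kl.
(* Both slot numbers are below [l], so division by [l] recovers the agent. *)
have ei : i = i'.
  apply: val_inj; have /(congr1 (divn^~ l)) := e.
  by rewrite !divnMDl // !divn_small // !addn0.
have ex : disutil D i o kk = disutil D i o kk'.
  by move: e; rewrite ei => /addnI.
case: (ltngtP kk kk') => // lt.
  by have := leq_trans (disutil_step ok) (disutil_mono i o lt); rewrite ex ltnn.
rewrite -ei in ok'.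
by have := leq_trans (disutil_step ok') (disutil_mono i o lt); rewrite ex ltnn.
Qed.

(** A needy timestep gets a project disapproved by the agent of its matched slot, any other one a
    project disapproved by nobody. Both searches succeed; [Ordinal m0] only makes [o] total. *)
Lemma matchable_feasible : 0 < m ->
  matchable l (needy n m l inp) (edge n m l (size A) inp) -> min_max_feasible D A.
Proof.
move=> m0 [f [fe finj]].
pose o (k : 'I_l) := odflt (Ordinal m0) (if m <= disapprovals n m l inp k
   then [pick p | [exists i : 'I_n, (val i == f k %/ l) && (p \in D i k)]]
   else [pick p | [forall i : 'I_n, p \notin D i k]]).
have oP (k : 'I_l) (i : 'I_n) : o k \in D i k ->
    needy n m l inp k /\ exists2 x, f k = i * l + x & slot_ok n m l (size A) inp k x.
  rewrite /o; case: (boolP (m <= disapprovals n m l inp k)) => nk.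
    have [i' [p [x [i'n pm b sx fk]]]] := fe k (ltn_ord k) nk.
    have l0 : 0 < l by apply: leq_ltn_trans (ltn_ord k).
    have [xl _] := slot_okP _ _ sx.
    have fd : f k %/ l = i' by rewrite fk divnMDl // divn_small // addn0.
    case: pickP => [q /existsP[j /andP[/eqP ej qj]] /= qi|none].
      split=> //; exists x => //; rewrite fk; congr (_ * _ + _).
      by rewrite -fd -ej (disapprover_unique qi qj).
    have /existsP[] := none (Ordinal pm).
    exists (Ordinal i'n); rewrite /= fd eqxx /=.
    by rewrite -bitE.
  case: pickP => [p /forallP/(_ i)/negPf -> //|none].
  case/negP: nk; apply/needyP=> p; have /negbT := none p.
  by rewrite negb_forall => /existsP[j]; rewrite negbK; exists j.
exists o => c cA; apply/bigmax_leqP=> i _.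
(* Timesteps charged to [i] before [c.1] use distinct slots below [c.2]; subtracting [i * l] embeds
   them in [iota 0 c.2]. *)
rewrite /disutil cardE -(size_map (fun k : 'I_l => f k - i * l)) -[X in _ <= X](size_iota 0).
apply: uniq_leq_size.
  rewrite map_inj_in_uniq ?enum_uniq // => k k'; rewrite !mem_enum !inE.
  move=> /andP[_ /oP[nk [x fx _]]] /andP[_ /oP[nk' [x' fx' _]]] e.
  apply: val_inj; apply: (finj _ _ (ltn_ord k) (ltn_ord k') nk nk').
  by move: e => /=; rewrite fx fx' !addKn => ->.
move=> y /mapP[k]; rewrite mem_enum inE => /andP[kc /oP[nk [x fx sx]]] ->.
by rewrite mem_iota /= fx addKn; have [_ /(_ c cA kc)] := slot_okP _ _ sx.
Qed.

End Encoding.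

(** * The decision program *)

(* Initially every low register holds input.  Doubling register 0, the input length S,
   yields an address 64 * S beyond the input without using any other register; then
   registers 1 to 39 are saved there, and B = 64 * S + 38 is the last address used. *)
Definition save_registers (t : nat) : program :=
  flatten [seq [:: IAdd 0 0 1; IStore 0 r] | r <- iota 2 t].

Definition prelude : program :=
  nseq 6 (IAdd 0 0 0) ++ [:: IStore 0 1; IConst 1 1] ++
  save_registers 38 ++ [:: IConst 1 0; IAdd 20 0 1].

Definition decider : program := prelude ++ ccode 0 (size prelude) Main.

(** As [Q] is at least 64, the targets from [Q + 1] on never meet registers 2 to 39, which are still
    to be saved. *)
Lemma save_registersP Q inp M t : 64 <= Q -> t <= 38 ->
  M 0 = Q -> M 1 = 1 -> M Q = inp 0 ->
  (forall x, 1 < x -> x != Q -> M x = inp x.-1) ->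
  let M' := foldl exec_mem M (save_registers t) in
  [/\ M' 0 = Q + t, M' 1 = 1 &
      forall x, 1 < x -> M' x = if Q <= x <= Q + t then inp (x - Q) else inp x.-1].
Proof.
move=> Q64 + M0 M1 MQ Mx; elim: t => [|t IH] t38.
  split; rewrite ?addn0 //= => x x1; rewrite -eqn_leq.
  case: (Q =P x) => [<-|/eqP nx]; first by rewrite subnn.
  by rewrite Mx // eq_sym.
have [I0 I1 Ix] := IH (ltnW t38).
rewrite /save_registers -[t.+1]addn1 iotaD map_cat flatten_cat foldl_cat /=.
move: I0 I1 Ix; rewrite -/(save_registers t); move: (foldl _ _ _) => M' I0 I1 Ix.
rewrite /exec_mem /= !updE I0 I1 /=.
have -> : (0 == Q + t + 1) = false by lia.
have -> : (1 == Q + t + 1) = false by lia.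
split=> [||x x1]; rewrite ?addnA // updE.
case: (x =P Q + t + 1) => [->|nx].
  by rewrite ifT ?Ix ?ifF //; try lia; congr inp; lia.
rewrite upd_neq; last lia.
by rewrite Ix //; congr (if _ then _ else _); lia.
Qed.

Lemma doublingP k M :
  let M' := foldl exec_mem M (nseq k (IAdd 0 0 0)) in
  M' 0 = 2 ^ k * M 0 /\ forall x, 0 < x -> M' x = M x.
Proof.
elim: k M => [|k IH] M /=; first by rewrite mul1n.
have [-> hx] := IH (exec_mem M (IAdd 0 0 0)); split=> [|x x0].
  by rewrite /exec_mem /= updE eqxx expnS; lia.
by rewrite hx // /exec_mem /= upd_neq //; lia.
Qed.

Lemma make_roomP M : let M' := foldl exec_mem M [:: IStore 0 1; IConst 1 1] in
  1 < M 0 -> [/\ M' 0 = M 0, M' 1 = 1, M' (M 0) = M 1 &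
    forall x, 1 < x -> x != M 0 -> M' x = M x].
Proof.
move=> M' h; rewrite /M' /exec_mem /=; split=> [||| x x1 xM].
- by rewrite !upd_neq //; lia.
- by rewrite updE.
- by rewrite upd_neq ?updE ?eqxx //; lia.
- by rewrite !upd_neq //; lia.
Qed.

Lemma set_boundP M : let M' := foldl exec_mem M [:: IConst 1 0; IAdd 20 0 1] in
  M' 20 = M 0 /\ forall x, 20 < x -> M' x = M x.
Proof.
rewrite /exec_mem /=; split=> [|x x1]; first by rewrite updE /= addn0.
by rewrite !upd_neq //; lia.
Qed.

Lemma preludeP input : 0 < size input ->
  let M := foldl exec_mem (Defs.mem (init_state input)) prelude in
  let B := 64 * size input + 38 in
  M 20 = B /\ loaded B (nth 0 input) (Store M (fun a => M (40 + a))).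
Proof.
move=> S0; rewrite /prelude (foldl_cat _ _ (nseq 6 _)) (foldl_cat _ _ [:: IStore 0 1; _]).
rewrite (foldl_cat _ _ (save_registers 38)).
have [] := doublingP 6 (Defs.mem (init_state input)).
move: (foldl _ (Defs.mem _) _) => M1; rewrite -[2 ^ 6]/64 => h0 hx.
set Q := 64 * size input in h0 *.
have {}h0 : M1 0 = Q by rewrite h0.
have {}hx x : 0 < x -> M1 x = nth 0 input x.-1 by move=> x0; rewrite hx //; case: x x0.
have Q64 : 64 <= Q by rewrite /Q; lia.
have := @make_roomP M1; rewrite h0; move: (foldl _ M1 _) => M2.
case=> [|k0 k1 kQ kx]; first by lia.
have {}kx x : 1 < x -> x != Q -> M2 x = nth 0 input x.-1.
  by move=> x1 xQ; rewrite kx // hx //; lia.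
rewrite hx // in kQ.
have := save_registersP Q64 (leqnn 38) k0 k1 kQ kx.
move: (foldl _ M2 _) => M3 [r0 _ rx].
have := set_boundP M3; move: (foldl _ M3 _) => M [m20 fr] /=.
have mx x : 40 <= x -> M x = if Q <= x <= Q + 38 then nth 0 input (x - Q) else nth 0 input x.-1.
  by move=> x40; rewrite fr ?rx //; lia.
split; first by rewrite m20 r0.
split=> /= [x x39|j jB|a aB]; rewrite mx; try lia.
- by rewrite ifT; [congr nth; lia | lia].
- by rewrite ifF; [congr nth; lia | lia].
- move: aB; rewrite -/Q => aB; rewrite ifF; last lia.
  by apply: nth_default; rewrite /Q in aB; lia.
Qed.

Lemma size_input_size input : size input <= input_size input.
Proof. by rewrite /input_size -sum1_size; apply: leq_sum. Qed.

(** The bound is a bare power, so constants move to the exponent: [2 <= X] gives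
    [P + W <= X ^ (P + W)] and [64 * X <= X ^ 7]. *)
Lemma time_bound X P W d B : 2 <= X -> B.+1 <= 64 * X ->
  P + W * B.+1 ^ d <= X ^ (P + W + 7 * d).
Proof.
move=> X2 BX.
have B7 : B.+1 ^ d <= X ^ (7 * d).
  rewrite expnM; case: d => [|d]; first by rewrite !expn0.
  rewrite leq_exp2r //; apply: leq_trans BX _.
  by rewrite expnSr leq_mul2r -[64]/(2 ^ 6) leq_exp2r ?X2 ?orbT.
rewrite expnD.
have X0 : 0 < X ^ (7 * d) by rewrite expn_gt0; lia.
have PW : P + W <= X ^ (P + W).
  apply: leq_trans (ltnW (ltn_expl (P + W) (ltnSn 1))) _.
  by case: (P + W) => // e; rewrite leq_exp2r.
apply: leq_trans (_ : (P + W) * X ^ (7 * d) <= _); last by rewrite leq_mul2r PW orbT.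
by rewrite mulnDl leq_add ?leq_pmulr // leq_mul2l B7 orbT.
Qed.

Lemma gamma_pos n m l (D : 'I_n -> 'I_l -> {set 'I_m}) :
  0 < gamma D -> [/\ 0 < n, 0 < m & 0 < l].
Proof.
move=> g; have H : ~ (n = 0 \/ m = 0 \/ l = 0).
  move=> h; have : gamma D <= 0; last by rewrite leqNgt g.
  apply/bigmax_leqP=> k _; apply/bigmax_leqP=> p _.
  case: h => [n0|[m0|l0]].
  - by apply: leq_trans (max_card _) _; rewrite card_ord n0.
  - by have := ltn_ord p; rewrite {2}m0.
  - by have := ltn_ord k; rewrite {2}l0.
by split; lia.
Qed.

Theorem theorem1 :
  exists (prog : program) (c : nat),
    forall (n m l : nat) (D : 'I_n -> 'I_l -> {set 'I_m}) (A : seq (nat * nat)),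
      valid_constraints l A ->
      gamma D = 1 ->
      exists k : nat,
        k <= (input_size (encode D A) + 2) ^ c /\
        decides_in prog (encode D A) k (min_max_feasible D A).
Proof.
exists decider, (size prelude + weight Main + 7 * depth Main).
move=> n m l D A _ g1.
have [n0 m0 l0] : [/\ 0 < n, 0 < m & 0 < l] by apply: (@gamma_pos n m l D); rewrite g1.
have gle : gamma D <= 1 by rewrite g1.
pose input := encode D A; pose S := size input.
have SE : S = 4 + n * l * m + (size A + size A) by exact: size_encode.
have S0 : 0 < S by rewrite SE; lia.
have [ca1 ca2] : code_at decider 0 prelude /\
    code_at decider (size prelude) (ccode 0 (size prelude) Main).
  by apply: code_at_cat => i _.
have r1 := straight_run (Defs.mem (init_state input)) ca1 isT.
have [M20 ld] := preludeP S0.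
move: (foldl _ _ _) r1 M20 ld => M r1 M20 ld.
rewrite -[State 0 _]/(init_state input) add0n in r1.
set B := 64 * size input + 38 in M20 ld.
set s := Store _ _ in ld.
(* The store is read off [M] itself, so only register 20 needs an argument. *)
have sim : simulates B s M := And3 (fun _ _ => erefl) M20 (fun _ => erefl).
have wf : wf_cmd 0 Main by [].
have [t [M' [tB r2 [hv _ _] _]]] := ccode_run wf ca2 sim.
exists (t + size prelude); split.
  rewrite addnC; apply: leq_trans (_ : size prelude + weight Main * B.+1 ^ depth Main <= _).
    by rewrite leq_add2l; apply: leq_trans tB (cost_bound _ _).
  apply: time_bound; first by rewrite addn2.
  rewrite -/input /B; move: (size_input_size input); lia.
rewrite /decides_in iterD r1 r2; split.
  rewrite /halted -[pc _]/(size prelude + size (ccode 0 (size prelude) Main)).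
  by rewrite -size_cat leqnn.
have M'0 := hv 0 isT.
have big x : 4 + n * l * m + (size A + size A) <= x -> nth 0 input x = 0.
  by rewrite -SE; exact: nth_default.
(* [B - 78] equals [64 * S - 40], which is at least [S] for positive [S]. *)
have fits : 4 + n * l * m + (size A + size A) <= B - 78 by rewrite -SE /B -/S; lia.
have header : [/\ nth 0 input 0 = n, nth 0 input 1 = m, nth 0 input 2 = l &
  nth 0 input 3 = size A] := And4 erefl erefl erefl erefl.
have [[v0 nP]|[v0 P]] := run_Main ld n0 m0 l0 fits header big.
  right; split; first exact: etrans M'0 v0.
  by move/(feasible_matchable gle); exact: nP.
left; split; first exact: etrans M'0 v0.
exact: matchable_feasible gle m0 P.
Qed.
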